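(* Let $X, Y$ be Banach spaces over $\mathbb{K}$. Suppose that $(X\times Y,\mathbb{K})$ has property $\mathbf{L}_{o,o}$ for bilinear forms. Then every tensor in $X\widehat{\otimes}_\pi Y$ can be approximated by tensors which attain their projective norm; that is, $\overline{\operatorname{NA}_\pi(X\widehat{\otimes}_\pi Y)}^{\|\cdot\|_\pi}=X\widehat{\otimes}_\pi Y$.
   Context: $\mathbb{K}$ is $\mathbb{R}$ or $\mathbb{C}$; $S_Z$ is the unit sphere of $Z$. The pair $(X\times Y,\mathbb{K})$ has property $\mathbf{L}_{o,o}$ for bilinear forms if for every $\varepsilon>0$ and every bounded bilinear form $B: X\times Y\to\mathbb{K}$ with $\|B\|=\sup_{S_X\times S_Y}|B|=1$, there exists $\eta(\varepsilon,B)>0$ such that whenever $(x,y)\in S_X\times S_Y$ satisfies $|B(x,y)|>1-\eta(\varepsilon,B)$, there is $(x_0,y_0)\in S_X\times S_Y$ with $|B(x_0,y_0)|=1$, $\|x-x_0\|<\varepsilon$ and $\|y-y_0\|<\varepsilon$. $X \widehat{\otimes}_\pi Y$ is the projective tensor product, the completion of $X \otimes Y$ under $\|z\|_\pi = \inf\{\sum_{n=1}^\infty \|x_n\|\|y_n\| : z = \sum_{n=1}^\infty x_n \otimes y_n,\ \sum_n\|x_n\|\|y_n\|<\infty\}$. $\operatorname{NA}_\pi(X \widehat{\otimes}_\pi Y)$ is the set of $z$ which attain their projective norm, i.e. for which there is a bounded sequence $(x_n,y_n)\subseteq X\times Y$ with $\sum_n\|x_n\|\|y_n\|<\infty$, $z=\sum_n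 x_n\otimes y_n$ and $\|z\|_\pi=\sum_n\|x_n\|\|y_n\|$. *)

(* Defs.v *)
From Stdlib Require Import Reals Lra Lia List Arith.
From Stdlib Require Import Classical ClassicalEpsilon PropExtensionality
  FunctionalExtensionality ProofIrrelevance.
From Stdlib Require Import ssreflect.
From Coquelicot Require Import Coquelicot.
Import ListNotations.
Open Scope R_scope.

Variant RC := Real | Complex.

Definition scalars (k : RC) : AbsRing :=
  match k with Real => R_AbsRing | Complex => C_AbsRing end.
Coercion scalars : RC >-> AbsRing.

Lemma scalars_mult_comm (k : RC) (a b : k) : mult a b = mult b a.
Proof.
destruct k; [exact (Rmult_comm a b) | exact (Cmult_comm a b)].
Qed.

Section Quotient.
Context {T : Type} (E : T -> T -> Prop).

Definition quot : Type := {P : T -> Prop | exists x, P = E x}.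
Definition cls (x : T) : quot := exist _ (E x) (ex_intro _ x eq_refl).
Definition repr (q : quot) : T :=
  proj1_sig (constructive_indefinite_description _ (proj2_sig q)).

Lemma cls_repr q : cls (repr q) = q.
Proof.
unfold repr.
destruct (constructive_indefinite_description _ (proj2_sig q)) as [x Hx]; simpl.
destruct q as [P HP]; simpl in Hx; subst P.
unfold cls; f_equal; apply proof_irrelevance.
Qed.

Hypothesis E_refl : forall x, E x x.
Hypothesis E_sym : forall x y, E x y -> E y x.
Hypothesis E_trans : forall x y z, E x y -> E y z -> E x z.

Lemma cls_eq x y : cls x = cls y <-> E x y.
Proof.
split.
- intros H. apply (f_equal (@proj1_sig _ _)) in H; simpl in H.
  rewrite H. apply E_refl.
- intros H.
  assert (HE : E x = E y).
  { apply functional_extensionality; intros z; apply propositional_extensionality.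
    split; eauto. }
  unfold cls. generalize (ex_intro (fun x0 => E x = E x0) x eq_refl).
  rewrite HE. intros e. f_equal. apply proof_irrelevance.
Qed.

Lemma repr_cls x : E (repr (cls x)) x.
Proof. apply cls_eq, cls_repr. Qed.

End Quotient.

Section Tensor.
Context {k : RC} (X Y : NormedModule k).

(* The list [(x1, y1); ...; (xn, yn)] stands for x1 (x) y1 + ... + xn (x) yn;
   no coefficients are needed, scalars being absorbed in the left factor, and
   the opposite of (x, y) is (opp x, y). *)
Inductive tensor_eq : list (X * Y) -> list (X * Y) -> Prop :=
| te_refl l : tensor_eq l l
| te_sym l m : tensor_eq l m -> tensor_eq m l
| te_trans l m n : tensor_eq l m -> tensor_eq m n -> tensor_eq l n
| te_app l l' m m' :
    tensor_eq l l' -> tensor_eq m m' -> tensor_eq (l ++ m) (l' ++ m')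
| te_comm l m : tensor_eq (l ++ m) (m ++ l)
| te_zero y : tensor_eq [(zero, y)] []
| te_plus_l x x' y : tensor_eq [(plus x x', y)] [(x, y); (x', y)]
| te_plus_r x y y' : tensor_eq [(x, plus y y')] [(x, y); (x, y')]
| te_scal (c : k) x y : tensor_eq [(scal c x, y)] [(x, scal c y)].

Definition tensor : Type := quot tensor_eq.

Definition tsum (l : list (X * Y)) : tensor := cls tensor_eq l.

Lemma tsum_eq l m : tsum l = tsum m <-> tensor_eq l m.
Proof. apply cls_eq; [exact te_refl | exact te_sym | exact te_trans]. Qed.

Definition lscal (c : k) (l : list (X * Y)) : list (X * Y) :=
  map (fun q => (scal c (fst q), snd q)) l.

Definition tensor_plus (s t : tensor) : tensor :=
  tsum (repr _ s ++ repr _ t).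
Definition tensor_zero : tensor := tsum [].
Definition tensor_scal (c : k) (t : tensor) : tensor :=
  tsum (lscal c (repr _ t)).
Definition tensor_opp (t : tensor) : tensor := tensor_scal (opp one) t.

Lemma tsum_repr t : tsum (repr _ t) = t.
Proof. apply cls_repr. Qed.

Lemma repr_tsum l : tensor_eq (repr _ (tsum l)) l.
Proof. apply tsum_eq, tsum_repr. Qed.

Lemma tsum_app l m : tsum (l ++ m) = tensor_plus (tsum l) (tsum m).
Proof. apply tsum_eq, te_sym, te_app; apply repr_tsum. Qed.

Lemma scal_swap (c d : k) (x : X) : scal c (scal d x) = scal d (scal c x).
Proof.
etransitivity; [exact (scal_assoc c d x)|].
rewrite scalars_mult_comm. symmetry. exact (scal_assoc d c x).
Qed.

Lemma lscal_eq c l m : tensor_eq l m -> tensor_eq (lscal c l) (lscal c m).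
Proof.
unfold lscal; induction 1; simpl.
- apply te_refl.
- now apply te_sym.
- eapply te_trans; eauto.
- rewrite !map_app. now apply te_app.
- rewrite !map_app. apply te_comm.
- exact (eq_ind_r (fun v : X => tensor_eq [(v, y)] []) (te_zero y) (scal_zero_r c)).
- exact (eq_ind_r (fun v : X => tensor_eq [(v, y)] _) (te_plus_l _ _ y)
    (scal_distr_l c x x')).
- apply te_plus_r.
- rewrite scal_swap. apply te_scal.
Qed.

Lemma tsum_lscal c l : tsum (lscal c l) = tensor_scal c (tsum l).
Proof. apply tsum_eq, te_sym, lscal_eq, repr_tsum. Qed.

Lemma tensor_ind (P : tensor -> Prop) : (forall l, P (tsum l)) -> forall t, P t.
Proof. intros H t. rewrite -(tsum_repr t). apply H. Qed.

Lemma tensor_plus_comm s t : tensor_plus s t = tensor_plus t s.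
Proof. apply tsum_eq, te_comm. Qed.

Lemma tensor_plus_assoc r s t :
  tensor_plus r (tensor_plus s t) = tensor_plus (tensor_plus r s) t.
Proof.
revert r s t; intros r s t.
induction r as [r] using tensor_ind; induction s as [s] using tensor_ind;
  induction t as [t] using tensor_ind.
rewrite -!tsum_app. now rewrite app_assoc.
Qed.

Lemma tensor_plus_zero t : tensor_plus t tensor_zero = t.
Proof.
induction t as [t] using tensor_ind.
unfold tensor_zero. rewrite -tsum_app. now rewrite app_nil_r.
Qed.

Lemma tensor_plus_opp t : tensor_plus t (tensor_opp t) = tensor_zero.
Proof.
induction t as [l] using tensor_ind.
unfold tensor_opp. rewrite -tsum_lscal -tsum_app. apply tsum_eq.
induction l as [|[x y] l IH]; [apply te_refl|].
change (tensor_eq ([(x, y)] ++ l ++ [(scal (opp one) x, y)] ++ lscal (opp one) l)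
          ([] ++ [])).
eapply te_trans.
{ apply te_app; [apply te_refl|].
  rewrite app_assoc. apply te_app; [apply te_comm | apply te_refl]. }
rewrite -app_assoc app_assoc. apply te_app; [|exact IH].
simpl. eapply te_trans; [apply te_sym, te_plus_l|].
refine (eq_ind_r (fun v : X => tensor_eq [(v, y)] []) (te_zero y) _).
etransitivity; [exact (f_equal (plus x) (scal_opp_one x)) | exact (plus_opp_r x)].
Qed.

Lemma tensor_scal_assoc a b t :
  tensor_scal a (tensor_scal b t) = tensor_scal (mult a b) t.
Proof.
induction t as [l] using tensor_ind.
rewrite -!tsum_lscal. f_equal. unfold lscal. rewrite map_map. apply map_ext.
intros [x y]; simpl. f_equal. exact (scal_assoc a b x).
Qed.

Lemma tensor_scal_one t : tensor_scal one t = t.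
Proof.
induction t as [l] using tensor_ind.
rewrite -tsum_lscal. f_equal. unfold lscal.
rewrite -{2}(map_id l). apply map_ext.
intros [x y]; simpl. f_equal. exact (scal_one x).
Qed.

Lemma tensor_scal_plus_r a s t :
  tensor_scal a (tensor_plus s t) = tensor_plus (tensor_scal a s) (tensor_scal a t).
Proof.
induction s as [s] using tensor_ind; induction t as [t] using tensor_ind.
rewrite -tsum_app -!tsum_lscal -tsum_app. f_equal. apply map_app.
Qed.

Lemma tensor_scal_plus_l a b t :
  tensor_scal (plus a b) t = tensor_plus (tensor_scal a t) (tensor_scal b t).
Proof.
induction t as [l] using tensor_ind.
rewrite -!tsum_lscal -tsum_app. apply tsum_eq.
induction l as [|[x y] l IH]; [apply te_refl|].
change (tensor_eq ([(scal (plus a b) x, y)] ++ lscal (plus a b) l)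
  ([(scal a x, y)] ++ lscal a l ++ [(scal b x, y)] ++ lscal b l)).
eapply te_trans;
  [apply te_app;
    [refine (eq_ind_r (fun v : X => tensor_eq [(v, y)] _) (te_plus_l _ _ y)
      (scal_distr_r a b x)) | exact IH]|].
change (tensor_eq ([(scal a x, y)] ++ [(scal b x, y)] ++ lscal a l ++ lscal b l)
  ([(scal a x, y)] ++ lscal a l ++ [(scal b x, y)] ++ lscal b l)).
apply te_app; [apply te_refl|].
rewrite !app_assoc. apply te_app; [apply te_comm | apply te_refl].
Qed.

Definition tensor_AbelianMonoid_mixin :=
  AbelianMonoid.Mixin tensor tensor_plus tensor_zero
    tensor_plus_comm tensor_plus_assoc tensor_plus_zero.
Canonical tensor_AbelianMonoid :=
  AbelianMonoid.Pack tensor tensor_AbelianMonoid_mixin tensor.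
Definition tensor_AbelianGroup_mixin :=
  AbelianGroup.Mixin tensor_AbelianMonoid tensor_opp tensor_plus_opp.
Canonical tensor_AbelianGroup :=
  AbelianGroup.Pack tensor
    (AbelianGroup.Class _ tensor_AbelianMonoid_mixin tensor_AbelianGroup_mixin)
    tensor.
Definition tensor_ModuleSpace_mixin :=
  ModuleSpace.Mixin k tensor_AbelianGroup tensor_scal
    tensor_scal_assoc tensor_scal_one tensor_scal_plus_r tensor_scal_plus_l.
Canonical tensor_ModuleSpace :=
  ModuleSpace.Pack k tensor
    (ModuleSpace.Class k _ (AbelianGroup.class tensor_AbelianGroup)
       tensor_ModuleSpace_mixin)
    tensor.

Definition cost (l : list (X * Y)) : R :=
  fold_right (fun q s => norm (fst q) * norm (snd q) + s) 0 l.

(* Infimum over finite representations; that in the completion it is also the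
   infimum over convergent series of elementary tensors is [proj_norm_series]. *)
Definition proj_norm (t : tensor) : R :=
  real (Glb_Rbar (fun r => exists l, t = tsum l /\ r = cost l)).

Lemma cost_ge0 l : 0 <= cost l.
Proof.
induction l as [|[x y] l IH]; simpl; [lra|].
pose proof (Rmult_le_pos _ _ (norm_ge_0 x) (norm_ge_0 y)). lra.
Qed.

Lemma cost_app l m : cost (l ++ m) = cost l + cost m.
Proof. induction l as [|[x y] l IH]; simpl; [ring|]. rewrite IH; ring. Qed.

Lemma cost_lscal c l : cost (lscal c l) <= abs c * cost l.
Proof.
induction l as [|[x y] l IH]; simpl; [lra|].
rewrite Rmult_plus_distr_l. apply Rplus_le_compat; [|exact IH].
rewrite -Rmult_assoc. apply Rmult_le_compat_r; [apply norm_ge_0|].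
apply norm_scal.
Qed.

Lemma proj_norm_glb t :
  is_glb_Rbar (fun r => exists l, t = tsum l /\ r = cost l) (proj_norm t).
Proof.
unfold proj_norm.
pose proof (Glb_Rbar_correct (fun r => exists l, t = tsum l /\ r = cost l)) as H.
destruct (Glb_Rbar _) as [g| |]; [exact H| |]; exfalso; destruct H as [Hlb Hglb].
- apply (Hlb (cost (repr _ t))). exists (repr _ t); now rewrite tsum_repr.
- apply (Hglb (Finite 0)). intros r [l [_ ->]]. apply cost_ge0.
Qed.

Lemma proj_norm_le l : proj_norm (tsum l) <= cost l.
Proof. apply (proj1 (proj_norm_glb (tsum l))). now exists l. Qed.

Lemma proj_norm_approx t eps :
  0 < eps -> exists l, t = tsum l /\ cost l < proj_norm t + eps.
Proof.
intros He. apply NNPP; intros Hn.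
assert (H : Rbar_le (proj_norm t + eps) (proj_norm t)).
{ apply (proj2 (proj_norm_glb t)). intros r [l [Hl ->]]. simpl.
  apply Rnot_lt_le; intros Hlt. apply Hn. now exists l. }
simpl in H; lra.
Qed.

Lemma proj_norm_triangle (s t : tensor) :
  proj_norm (plus s t) <= proj_norm s + proj_norm t.
Proof.
apply le_epsilon; intros eps He.
destruct (proj_norm_approx s (eps / 2)) as [l [Hl Hl']]; [lra|].
destruct (proj_norm_approx t (eps / 2)) as [m [Hm Hm']]; [lra|].
assert (H : proj_norm (tsum (l ++ m)) <= cost l + cost m)
  by (rewrite -cost_app; apply proj_norm_le).
rewrite tsum_app -Hl -Hm in H.
change (plus s t) with (tensor_plus s t). lra.
Qed.

Lemma proj_norm_scal (c : k) (t : tensor) :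
  proj_norm (scal c t) <= abs c * proj_norm t.
Proof.
apply le_epsilon; intros eps He.
assert (Hc : 0 <= abs c) by apply abs_ge_0.
destruct (proj_norm_approx t (eps / (abs c + 1))) as [l [Hl Hl']].
{ apply Rdiv_lt_0_compat; lra. }
change (scal c t) with (tensor_scal c t).
rewrite {1}Hl -tsum_lscal.
eapply Rle_trans; [apply proj_norm_le|].
eapply Rle_trans; [apply cost_lscal|].
apply Rle_trans with (abs c * (proj_norm t + eps / (abs c + 1))).
{ apply Rmult_le_compat_l; lra. }
rewrite Rmult_plus_distr_l. apply Rplus_le_compat_l.
apply Rle_trans with ((abs c + 1) * (eps / (abs c + 1))).
- apply Rmult_le_compat_r; [|lra]. apply Rlt_le, Rdiv_lt_0_compat; lra.
- right; field; lra.
Qed.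

End Tensor.

Record is_seminorm {K : AbsRing} {V : ModuleSpace K} (p : V -> R) : Prop := {
  seminorm_triangle : forall u v, p (plus u v) <= p u + p v;
  seminorm_scal : forall (c : K) u, p (scal c u) <= abs c * p u }.

Section Completion.
Context {K : AbsRing} (V : ModuleSpace K) (p : V -> R) (Hp : is_seminorm p).

Definition cauchy_seq (u : nat -> V) : Prop :=
  forall eps, 0 < eps -> exists N, forall n m, (N <= n)%nat -> (N <= m)%nat ->
    p (minus (u n) (u m)) < eps.

Definition cseq : Type := {u : nat -> V | cauchy_seq u}.

Definition cseq_eq (u v : cseq) : Prop :=
  is_lim_seq (fun n => p (minus (proj1_sig u n) (proj1_sig v n))) 0.

(* Cauchy sequences modulo null sequences; as [p] may vanish on nonzero
   vectors, this also performs the separation. *)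
Definition completion : Type := quot cseq_eq.

Lemma p_zero_le : p zero <= 0.
Proof.
rewrite -(scal_zero_l zero). eapply Rle_trans; [apply (seminorm_scal _ Hp)|].
assert (H : abs (zero : K) = 0) by apply abs_zero.
replace (abs _) with 0 by (symmetry; exact H). lra.
Qed.

Lemma p_opp_le u : p (opp u) <= p u.
Proof.
rewrite -scal_opp_one. eapply Rle_trans; [apply (seminorm_scal _ Hp)|].
rewrite abs_opp_one; lra.
Qed.

Lemma p_opp u : p (opp u) = p u.
Proof.
apply Rle_antisym; [apply p_opp_le|].
rewrite -{1}(opp_opp u). apply p_opp_le.
Qed.

Lemma p_zero : p zero = 0.
Proof.
apply Rle_antisym; [apply p_zero_le|].
pose proof (seminorm_triangle _ Hp zero zero) as H. rewrite plus_zero_r in H. lra.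
Qed.

Lemma p_ge0 u : 0 <= p u.
Proof.
pose proof (seminorm_triangle _ Hp u (opp u)) as H.
rewrite plus_opp_r p_opp p_zero in H. lra.
Qed.

Lemma p_minus_sym u v : p (minus u v) = p (minus v u).
Proof. now rewrite -opp_minus p_opp. Qed.

Lemma p_minus_trans u v w : p (minus u w) <= p (minus u v) + p (minus v w).
Proof. rewrite (minus_trans v). apply (seminorm_triangle _ Hp). Qed.

Lemma minus_plus_plus (a b c d : V) :
  minus (plus a b) (plus c d) = plus (minus a c) (minus b d).
Proof.
unfold minus. rewrite opp_plus -!plus_assoc. f_equal.
rewrite !plus_assoc. f_equal. apply plus_comm.
Qed.

Lemma p_diff u v : Rabs (p u - p v) <= p (minus u v).
Proof.
assert (H : forall a b, p a <= p b + p (minus a b)).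
{ intros a b. replace a with (plus b (minus a b)) at 1; [apply (seminorm_triangle _ Hp)|].
  unfold minus. rewrite plus_comm -plus_assoc plus_opp_l. apply plus_zero_r. }
apply Rabs_le. pose proof (H u v). pose proof (H v u) as H'.
rewrite (p_minus_sym v u) in H'. lra.
Qed.

Lemma lim0_le (a b : nat -> R) :
  (forall n, 0 <= a n <= b n) -> is_lim_seq b 0 -> is_lim_seq a 0.
Proof.
intros H Hb. apply is_lim_seq_le_le with (fun _ => 0) b; auto.
apply is_lim_seq_const.
Qed.

Lemma lim0_plus (a b : nat -> R) :
  is_lim_seq a 0 -> is_lim_seq b 0 -> is_lim_seq (fun n => a n + b n) 0.
Proof.
intros Ha Hb. replace (Finite 0) with (Finite (0 + 0)) by (f_equal; ring).
now apply is_lim_seq_plus'.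
Qed.

Lemma lim0_scal c (a : nat -> R) :
  is_lim_seq a 0 -> is_lim_seq (fun n => c * a n) 0.
Proof.
intros Ha. replace (Finite 0) with (Rbar_mult c 0).
- now apply is_lim_seq_scal_l.
- simpl. f_equal. ring.
Qed.

Lemma cseq_eq_refl u : cseq_eq u u.
Proof.
apply is_lim_seq_ext with (fun _ => 0); [|apply is_lim_seq_const].
intros n. rewrite minus_eq_zero. now rewrite p_zero.
Qed.

Lemma cseq_eq_sym u v : cseq_eq u v -> cseq_eq v u.
Proof. apply is_lim_seq_ext. intros n; apply p_minus_sym. Qed.

Lemma cseq_eq_trans u v w : cseq_eq u v -> cseq_eq v w -> cseq_eq u w.
Proof.
intros H1 H2. eapply lim0_le; [|apply (lim0_plus _ _ H1 H2)].
intros n; split; [apply p_ge0 | apply p_minus_trans].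
Qed.

Definition cmk (u : nat -> V) (Hu : cauchy_seq u) : completion :=
  cls cseq_eq (exist _ u Hu).

Lemma cmk_eq u v Hu Hv :
  cmk u Hu = cmk v Hv <-> is_lim_seq (fun n => p (minus (u n) (v n))) 0.
Proof.
exact (cls_eq _ cseq_eq_refl cseq_eq_sym cseq_eq_trans (exist _ u Hu) (exist _ v Hv)).
Qed.

Definition crep (z : completion) : nat -> V := proj1_sig (repr _ z).
Lemma crep_cauchy z : cauchy_seq (crep z).
Proof. exact (proj2_sig (repr _ z)). Qed.

Lemma cmk_crep z : cmk (crep z) (crep_cauchy z) = z.
Proof.
etransitivity; [|exact (cls_repr _ z)]. unfold cmk. f_equal.
generalize (crep_cauchy z). unfold crep. destruct (repr cseq_eq z) as [u Hu]; simpl.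
intros Hu'. f_equal. apply proof_irrelevance.
Qed.

Lemma completion_ind (P : completion -> Prop) :
  (forall u Hu, P (cmk u Hu)) -> forall z, P z.
Proof. intros H z. rewrite -(cmk_crep z). apply H. Qed.

Lemma cauchy_plus u v : cauchy_seq u -> cauchy_seq v ->
  cauchy_seq (fun n => plus (u n) (v n)).
Proof.
intros Hu Hv eps He.
destruct (Hu (eps / 2)) as [N HN]; [lra|].
destruct (Hv (eps / 2)) as [M HM]; [lra|].
exists (N + M)%nat. intros n m Hn Hm.
rewrite minus_plus_plus.
eapply Rle_lt_trans; [apply (seminorm_triangle _ Hp)|].
specialize (HN n m ltac:(lia) ltac:(lia)).
specialize (HM n m ltac:(lia) ltac:(lia)). lra.
Qed.

Lemma cauchy_scal c u : cauchy_seq u -> cauchy_seq (fun n => scal c (u n)).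
Proof.
intros Hu eps He. pose proof (abs_ge_0 c) as Hc.
destruct (Hu (eps / (abs c + 1))) as [N HN]; [apply Rdiv_lt_0_compat; lra|].
exists N. intros n m Hn Hm. specialize (HN n m Hn Hm).
rewrite -scal_minus_distr_l.
eapply Rle_lt_trans; [apply (seminorm_scal _ Hp)|].
apply Rle_lt_trans with ((abs c + 1) * p (minus (u n) (u m))).
- apply Rmult_le_compat_r; [apply p_ge0 | lra].
- apply Rmult_lt_reg_r with (/ (abs c + 1)); [apply Rinv_0_lt_compat; lra|].
  unfold Rdiv in HN.
  replace ((abs c + 1) * p (minus (u n) (u m)) * / (abs c + 1))
    with (p (minus (u n) (u m))) by (field; lra).
  exact HN.
Qed.

Lemma cauchy_const v : cauchy_seq (fun _ => v).
Proof. intros eps He. exists 0%nat. intros. now rewrite minus_eq_zero p_zero. Qed.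

Definition incl (v : V) : completion := cmk (fun _ => v) (cauchy_const v).

Definition completion_plus (z w : completion) : completion :=
  cmk _ (cauchy_plus _ _ (crep_cauchy z) (crep_cauchy w)).
Definition completion_zero : completion := incl zero.
Definition completion_scal (c : K) (z : completion) : completion :=
  cmk _ (cauchy_scal c _ (crep_cauchy z)).
Definition completion_opp (z : completion) : completion :=
  completion_scal (opp one) z.
Definition completion_norm (z : completion) : R :=
  real (Lim_seq (fun n => p (crep z n))).

Lemma crep_cmk u Hu : is_lim_seq (fun n => p (minus (crep (cmk u Hu) n) (u n))) 0.
Proof. exact (proj1 (cmk_eq _ _ (crep_cauchy _) Hu) (cmk_crep _)). Qed.

Lemma cmk_plus u v Hu Hv :
  completion_plus (cmk u Hu) (cmk v Hv) = cmk _ (cauchy_plus u v Hu Hv).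
Proof.
apply cmk_eq. eapply lim0_le; [|apply (lim0_plus _ _ (crep_cmk u Hu) (crep_cmk v Hv))].
intros n; split; [apply p_ge0|]. cbv beta.
rewrite minus_plus_plus. apply (seminorm_triangle _ Hp).
Qed.

Lemma cmk_scal c u Hu :
  completion_scal c (cmk u Hu) = cmk _ (cauchy_scal c u Hu).
Proof.
apply cmk_eq. eapply lim0_le; [|apply (lim0_scal (abs c) _ (crep_cmk u Hu))].
intros n; split; [apply p_ge0|]. cbv beta.
rewrite -scal_minus_distr_l. apply (seminorm_scal _ Hp).
Qed.

Lemma cmk_ext u v Hu Hv : (forall n, u n = v n) -> cmk u Hu = cmk v Hv.
Proof.
intros H. apply cmk_eq. apply is_lim_seq_ext with (fun _ => 0);
  [|apply is_lim_seq_const].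
intros n. now rewrite H minus_eq_zero p_zero.
Qed.

Lemma is_lim_norm u Hu : is_lim_seq (fun n => p (u n)) (completion_norm (cmk u Hu)).
Proof.
assert (H : ex_finite_lim_seq (fun n => p (u n))).
{ apply ex_lim_seq_cauchy_corr. intros eps.
  destruct (Hu eps (cond_pos eps)) as [N HN]. exists N. intros n m Hn Hm.
  eapply Rle_lt_trans; [apply p_diff | now apply HN]. }
destruct H as [l Hl].
assert (H : is_lim_seq (fun n => p (crep (cmk u Hu) n)) l).
{ apply is_lim_seq_ext with
    (fun n => p (u n) + (p (crep (cmk u Hu) n) - p (u n))); [intros; ring|].
  replace l with (l + 0) by ring. apply is_lim_seq_plus'; [exact Hl|].
  apply is_lim_seq_abs_0. eapply lim0_le; [|exact (crep_cmk u Hu)].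
  intros n; split; [apply Rabs_pos | apply p_diff]. }
unfold completion_norm. now rewrite (is_lim_seq_unique _ _ H).
Qed.

Lemma completion_plus_comm z w : completion_plus z w = completion_plus w z.
Proof. apply cmk_ext. intros; apply plus_comm. Qed.

Lemma completion_plus_assoc z w v :
  completion_plus z (completion_plus w v) = completion_plus (completion_plus z w) v.
Proof.
induction z as [a Ha] using completion_ind; induction w as [b Hb] using completion_ind;
  induction v as [c Hc] using completion_ind.
rewrite !cmk_plus. apply cmk_ext. intros; apply plus_assoc.
Qed.

Lemma completion_plus_zero z : completion_plus z completion_zero = z.
Proof.
induction z as [a Ha] using completion_ind. unfold completion_zero, incl.
rewrite cmk_plus. apply cmk_ext. intros; apply plus_zero_r.
Qed.

Lemma completion_plus_opp z : completion_plus z (completion_opp z) = completion_zero.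
Proof.
induction z as [a Ha] using completion_ind. unfold completion_opp.
rewrite cmk_scal cmk_plus. apply cmk_ext. intros n.
rewrite scal_opp_one. exact (plus_opp_r (a n)).
Qed.

Lemma completion_scal_assoc a b z :
  completion_scal a (completion_scal b z) = completion_scal (mult a b) z.
Proof.
induction z as [u Hu] using completion_ind.
rewrite !cmk_scal. apply cmk_ext. intros; apply scal_assoc.
Qed.

Lemma completion_scal_one z : completion_scal one z = z.
Proof.
induction z as [u Hu] using completion_ind.
rewrite !cmk_scal. apply cmk_ext. intros; apply scal_one.
Qed.

Lemma completion_scal_plus_r a z w :
  completion_scal a (completion_plus z w)
  = completion_plus (completion_scal a z) (completion_scal a w).
Proof.
induction z as [u Hu] using completion_ind; induction w as [v Hv] using completion_ind.
rewrite cmk_plus !cmk_scal cmk_plus. apply cmk_ext. intros; apply scal_distr_l.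
Qed.

Lemma completion_scal_plus_l a b z :
  completion_scal (plus a b) z
  = completion_plus (completion_scal a z) (completion_scal b z).
Proof.
induction z as [u Hu] using completion_ind.
rewrite !cmk_scal cmk_plus. apply cmk_ext. intros n; exact (scal_distr_r a b (u n)).
Qed.

Definition completion_AbelianMonoid_mixin :=
  AbelianMonoid.Mixin completion completion_plus completion_zero
    completion_plus_comm completion_plus_assoc completion_plus_zero.
Definition completion_AbelianMonoid :=
  AbelianMonoid.Pack completion completion_AbelianMonoid_mixin completion.
Definition completion_AbelianGroup_mixin :=
  AbelianGroup.Mixin completion_AbelianMonoid completion_opp completion_plus_opp.
Definition completion_AbelianGroup :=
  AbelianGroup.Pack completion
    (AbelianGroup.Class _ completion_AbelianMonoid_mixin completion_AbelianGroup_mixin)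
    completion.
Definition completion_ModuleSpace_mixin :=
  ModuleSpace.Mixin K completion_AbelianGroup completion_scal
    completion_scal_assoc completion_scal_one
    completion_scal_plus_r completion_scal_plus_l.
Definition completion_ModuleSpace :=
  ModuleSpace.Pack K completion
    (ModuleSpace.Class K _ (AbelianGroup.class completion_AbelianGroup)
       completion_ModuleSpace_mixin)
    completion.

Lemma completion_norm_triangle (z w : completion_ModuleSpace) :
  completion_norm (plus z w) <= completion_norm z + completion_norm w.
Proof.
change (completion_norm (completion_plus z w) <= completion_norm z + completion_norm w).
induction z as [u Hu] using completion_ind; induction w as [v Hv] using completion_ind.
rewrite cmk_plus.
eapply (is_lim_seq_le (fun n => p (plus (u n) (v n))) (fun n => p (u n) + p (v n))
  (Finite _) (Finite _)).
- intros n. apply (seminorm_triangle _ Hp).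
- apply (is_lim_norm (fun n => plus (u n) (v n))).
- apply is_lim_seq_plus'; apply is_lim_norm.
Qed.

Lemma completion_norm_scal (c : K) (z : completion_ModuleSpace) :
  completion_norm (scal c z) <= abs c * completion_norm z.
Proof.
change (completion_norm (completion_scal c z) <= abs c * completion_norm z).
induction z as [u Hu] using completion_ind.
rewrite cmk_scal.
eapply (is_lim_seq_le (fun n => p (scal c (u n))) (fun n => abs c * p (u n))
  (Finite _) (Finite _)).
- intros n. apply (seminorm_scal _ Hp).
- apply (is_lim_norm (fun n => scal c (u n))).
- apply (is_lim_seq_scal_l _ (abs c) (Finite _)), is_lim_norm.
Qed.

Lemma completion_norm_eq_zero (z : completion_ModuleSpace) :
  completion_norm z = 0 -> z = zero.
Proof.
change (completion_norm z = 0 -> z = completion_zero).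
induction z as [u Hu] using completion_ind. intros H.
apply cmk_eq. apply is_lim_seq_ext with (fun n => p (u n)).
- intros n. now rewrite minus_zero_r.
- rewrite -H. apply is_lim_norm.
Qed.

Lemma completion_norm_opp (z : completion_ModuleSpace) :
  completion_norm (opp z) <= completion_norm z.
Proof.
rewrite -scal_opp_one. eapply Rle_trans; [apply completion_norm_scal|].
rewrite abs_opp_one. lra.
Qed.

Definition completion_ball (z : completion_ModuleSpace) (eps : R)
  (w : completion_ModuleSpace) : Prop := completion_norm (minus w z) < eps.

Lemma completion_norm_zero : completion_norm (zero : completion_ModuleSpace) = 0.
Proof.
assert (H := is_lim_norm (fun _ => zero) (cauchy_const zero)).
apply is_lim_seq_unique in H. rewrite Lim_seq_const p_zero in H.
injection H as H. symmetry. exact H.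
Qed.

Lemma completion_ball_center z (e : posreal) : completion_ball z e z.
Proof.
unfold completion_ball. rewrite minus_eq_zero completion_norm_zero. apply cond_pos.
Qed.

Lemma completion_ball_sym z w e : completion_ball z e w -> completion_ball w e z.
Proof.
unfold completion_ball. apply Rle_lt_trans. rewrite -(opp_minus w z).
apply completion_norm_opp.
Qed.

Lemma completion_ball_triangle x y z e1 e2 :
  completion_ball x e1 y -> completion_ball y e2 z -> completion_ball x (e1 + e2) z.
Proof.
unfold completion_ball. intros H1 H2. rewrite (minus_trans y).
eapply Rle_lt_trans; [apply completion_norm_triangle | lra].
Qed.

Definition completion_UniformSpace_mixin :=
  UniformSpace.Mixin completion completion_zero completion_ball
    completion_ball_center completion_ball_sym completion_ball_triangle.
Definition completion_NormedModuleAux :=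
  NormedModuleAux.Pack K completion
    (NormedModuleAux.Class K _ (ModuleSpace.class K completion_ModuleSpace)
      completion_UniformSpace_mixin)
    completion.

Lemma completion_norm_compat1 (x y : completion_NormedModuleAux) (eps : R) :
  completion_norm (minus y x) < eps -> ball x eps y.
Proof. exact (fun H => H). Qed.

Lemma completion_norm_compat2 (x y : completion_NormedModuleAux) (eps : posreal) :
  ball x eps y -> completion_norm (minus y x) < 1 * eps.
Proof. rewrite Rmult_1_l. exact (fun H => H). Qed.

Definition completion_NormedModule_mixin :=
  NormedModule.Mixin K completion_NormedModuleAux completion_norm 1
    completion_norm_triangle completion_norm_scal
    completion_norm_compat1 completion_norm_compat2 completion_norm_eq_zero.
Definition completion_NormedModule :=
  NormedModule.Pack K completion
    (NormedModule.Class K _ (NormedModuleAux.class K completion_NormedModuleAux)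
      completion_NormedModule_mixin)
    completion.

Lemma norm_incl v : @norm K completion_NormedModule (incl v) = p v.
Proof.
change (completion_norm (incl v) = p v).
assert (H := is_lim_norm (fun _ => v) (cauchy_const v)).
apply is_lim_seq_unique in H. rewrite Lim_seq_const in H.
injection H as H. symmetry; exact H.
Qed.

Lemma incl_plus u v :
  incl (plus u v) = @plus completion_NormedModule (incl u) (incl v).
Proof.
change (incl (plus u v) = completion_plus (incl u) (incl v)).
unfold incl. rewrite cmk_plus. now apply cmk_ext.
Qed.

Lemma incl_scal c v :
  incl (scal c v) = @scal K completion_NormedModule c (incl v).
Proof.
change (incl (scal c v) = completion_scal c (incl v)).
unfold incl. rewrite cmk_scal. now apply cmk_ext.
Qed.

Lemma incl_opp v : incl (opp v) = @opp completion_NormedModule (incl v).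
Proof.
etransitivity; [exact (f_equal incl (eq_sym (scal_opp_one v)))|].
etransitivity; [apply incl_scal|].
exact (scal_opp_one (incl v : completion_NormedModule)).
Qed.

Lemma incl_minus u v :
  incl (minus u v) = @minus completion_NormedModule (incl u) (incl v).
Proof. unfold minus. now rewrite incl_plus incl_opp. Qed.

Lemma cmk_incl u Hu eps : 0 < eps -> exists N, forall n, (N <= n)%nat ->
  @norm K completion_NormedModule
    (@minus completion_NormedModule (cmk u Hu) (incl (u n))) < eps.
Proof.
intros He. destruct (Hu (eps / 2)) as [N HN]; [lra|].
exists N. intros n Hn.
assert (E : @minus completion_NormedModule (cmk u Hu) (incl (u n))
  = cmk _ (cauchy_plus u (fun _ => opp (u n)) Hu (cauchy_const _))).
{ unfold minus. rewrite -incl_opp.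
  change (completion_plus (cmk u Hu) (incl (opp (u n)))
    = cmk _ (cauchy_plus u (fun _ => opp (u n)) Hu (cauchy_const _))).
  unfold incl. apply cmk_plus. }
rewrite E. apply Rle_lt_trans with (eps / 2); [|lra].
assert (H := is_lim_norm _ (cauchy_plus u (fun _ => opp (u n)) Hu (cauchy_const _))).
refine (is_lim_seq_le_loc _ (fun _ => eps / 2) (Finite _) (Finite _) _ H
          (is_lim_seq_const _)).
exists N. intros m Hm. left. exact (HN m n Hm Hn).
Qed.

Lemma incl_dense (z : completion_NormedModule) eps :
  0 < eps -> exists v, norm (minus z (incl v : completion_NormedModule)) < eps.
Proof.
intros He. rewrite -(cmk_crep z).
destruct (cmk_incl _ (crep_cauchy z) eps He) as [N HN].
exists (crep z N). now apply HN.
Qed.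

Lemma completion_complete (F : (completion_NormedModule -> Prop) -> Prop) :
  ProperFilter F -> cauchy F ->
  exists z : completion_NormedModule, forall eps : posreal, F (ball z eps).
Proof.
intros PF CF.
assert (Hd : forall n : nat, 0 < / (INR n + 1))
  by (intros n; apply Rinv_0_lt_compat; pose proof (pos_INR n); lra).
assert (H : forall n : nat, exists v : V,
  F (fun w => norm (minus w (incl v : completion_NormedModule)) < 2 * / (INR n + 1))).
{ intros n. destruct (CF (mkposreal _ (Hd n))) as [x Hx].
  destruct (incl_dense x _ (Hd n)) as [v Hv].
  exists v. revert Hx. apply filter_imp. intros w Hw.
  change (norm (minus w x) < / (INR n + 1)) in Hw.
  rewrite (minus_trans x). eapply Rle_lt_trans; [apply norm_triangle | lra]. }
set (u := fun n => proj1_sig (constructive_indefinite_description _ (H n))).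
assert (Hu : forall n, F (fun w =>
  norm (minus w (incl (u n) : completion_NormedModule)) < 2 * / (INR n + 1))).
{ intros n. unfold u. now destruct (constructive_indefinite_description _ (H n)). }
assert (Huu : forall n m, p (minus (u n) (u m)) < 2 * / (INR n + 1) + 2 * / (INR m + 1)).
{ intros n m.
  destruct (filter_ex _ (filter_and _ _ (Hu n) (Hu m))) as [w [Hn Hm]].
  rewrite -norm_incl incl_minus.
  rewrite (minus_trans (w : completion_NormedModule)).
  eapply Rle_lt_trans; [apply norm_triangle|].
  rewrite -opp_minus norm_opp. lra. }
assert (Hsmall : forall eps, 0 < eps -> exists N : nat, forall n, (N <= n)%nat ->
  2 * / (INR n + 1) < eps).
{ intros eps He. destruct (archimed_cor1 (eps / 2)) as [N [HN HN0]]; [lra|].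
  exists N. intros n Hn.
  assert (/ (INR n + 1) <= / INR N).
  { apply Rinv_le_contravar; [now apply lt_0_INR|]. apply le_INR in Hn. lra. }
  lra. }
assert (Hc : cauchy_seq u).
{ intros eps He. destruct (Hsmall (eps / 2)) as [N HN]; [lra|].
  exists N. intros n m Hn Hm.
  pose proof (Huu n m). pose proof (HN n Hn). pose proof (HN m Hm). lra. }
exists (cmk u Hc). intros eps.
destruct (Hsmall (eps / 2)) as [N HN]; [apply is_pos_div_2|].
destruct (cmk_incl u Hc (eps / 2)) as [M HM]; [apply is_pos_div_2|].
specialize (HN (N + M)%nat ltac:(lia)). specialize (HM (N + M)%nat ltac:(lia)).
generalize (Hu (N + M)%nat). apply filter_imp. intros w Hw.
change (norm (minus w (cmk u Hc : completion_NormedModule)) < eps).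
rewrite (minus_trans (incl (u (N + M)%nat) : completion_NormedModule)).
eapply Rle_lt_trans; [apply norm_triangle|].
rewrite -(opp_minus (cmk u Hc : completion_NormedModule)) norm_opp. lra.
Qed.

Definition completion_lim (F : (completion_NormedModule -> Prop) -> Prop) :
  completion_NormedModule :=
  epsilon (inhabits completion_zero)
    (fun z : completion_NormedModule => forall eps : posreal, F (ball z eps)).

Lemma completion_lim_cauchy F : ProperFilter F -> cauchy F ->
  forall eps : posreal, F (ball (completion_lim F) eps).
Proof.
intros PF CF. unfold completion_lim.
apply (epsilon_spec (inhabits completion_zero)
  (fun z : completion_NormedModule => forall eps : posreal, F (ball z eps))).
now apply completion_complete.
Qed.

Lemma completion_lim_close F1 F2 : filter_le F1 F2 -> filter_le F2 F1 ->
  close (completion_lim F1) (completion_lim F2).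
Proof.
intros H1 H2.
assert (E : F1 = F2).
{ apply functional_extensionality; intros P. apply propositional_extensionality.
  split; [apply H2 | apply H1]. }
rewrite E. apply close_refl.
Qed.

Definition completion_CompleteSpace_mixin :=
  CompleteSpace.Mixin completion_NormedModule completion_lim
    completion_lim_cauchy completion_lim_close.
Definition completion_CompleteNormedModule :=
  CompleteNormedModule.Pack K completion
    (CompleteNormedModule.Class K _ (NormedModule.class K completion_NormedModule)
      completion_CompleteSpace_mixin)
    completion.

End Completion.

Section Projective.
Context {k : RC}.

Lemma proj_norm_seminorm (X Y : NormedModule k) :
  is_seminorm (V := tensor_ModuleSpace X Y) (proj_norm X Y).
Proof. split; [apply proj_norm_triangle | apply proj_norm_scal]. Qed.

Definition proj_tensor (X Y : NormedModule k) : CompleteNormedModule k :=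
  completion_CompleteNormedModule (tensor_ModuleSpace X Y) (proj_norm X Y)
    (proj_norm_seminorm X Y).

Context {X Y : NormedModule k}.

Definition tensor_incl (t : tensor X Y) : proj_tensor X Y :=
  incl (tensor_ModuleSpace X Y) (proj_norm X Y) (proj_norm_seminorm X Y) t.

Definition tens (x : X) (y : Y) : proj_tensor X Y :=
  tensor_incl (tsum X Y [(x, y)]).

Definition attains_proj_norm (z : proj_tensor X Y) : Prop :=
  exists (x : nat -> X) (y : nat -> Y),
    (exists M, forall n, norm (x n) <= M /\ norm (y n) <= M) /\
    is_series (fun n => tens (x n) (y n)) z /\
    is_series (fun n => norm (x n) * norm (y n)) (norm z).

Lemma norm_tensor_incl t : norm (tensor_incl t) = proj_norm X Y t.
Proof. exact (norm_incl _ _ (proj_norm_seminorm X Y) t). Qed.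

Lemma tensor_incl_plus s t :
  tensor_incl (plus s t) = plus (tensor_incl s) (tensor_incl t).
Proof. exact (incl_plus _ _ (proj_norm_seminorm X Y) s t). Qed.

Lemma tensor_incl_dense (z : proj_tensor X Y) eps :
  0 < eps -> exists t, norm (minus z (tensor_incl t)) < eps.
Proof. exact (incl_dense _ _ (proj_norm_seminorm X Y) z eps). Qed.

Let psum (l : list (X * Y)) : proj_tensor X Y := tensor_incl (tsum X Y l).

Lemma psum_app l m : psum (l ++ m) = plus (psum l) (psum m).
Proof. unfold psum. rewrite tsum_app. apply tensor_incl_plus. Qed.

Lemma psum_nil : psum [] = zero.
Proof. reflexivity. Qed.

Lemma norm_psum_le l : norm (psum l) <= cost X Y l.
Proof. unfold psum. rewrite norm_tensor_incl. apply proj_norm_le. Qed.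

Lemma norm_tens_le x y : norm (tens x y) <= norm x * norm y.
Proof.
pose proof (norm_psum_le [(x, y)]) as H. simpl in H. unfold tens, psum in *. lra.
Qed.

Let f0 : X * Y := (zero, zero).

Lemma sum_n_nth {G : AbelianMonoid} (g : X * Y -> G) (S : list (X * Y) -> G)
  (Snil : S [] = zero) (Sapp : forall l q, S (l ++ [q]) = plus (S l) (g q)) l :
  l <> [] -> sum_n (fun n => g (nth n l f0)) (length l - 1) = S l.
Proof.
induction l as [|q l IH] using rev_ind; [now intros []|]. intros _.
rewrite length_app Sapp. simpl.
replace (length l + 1 - 1)%nat with (length l) by lia.
destruct l as [|q' l'].
{ simpl. rewrite sum_O Snil plus_zero_l. reflexivity. }
remember (q' :: l') as l eqn:El.
assert (Hl : length l = Datatypes.S (length l - 1)) by (rewrite El; simpl; lia).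
rewrite Hl sum_Sn -Hl. f_equal.
- rewrite -IH; [|rewrite El; discriminate].
  apply sum_n_ext_loc. intros n Hn. f_equal. apply app_nth1. lia.
- f_equal. now rewrite nth_middle.
Qed.

Lemma series_norm_ge (z : proj_tensor X Y) (x : nat -> X) (y : nat -> Y) (s : R) :
  is_series (fun n => norm (x n) * norm (y n)) s ->
  is_series (fun n => tens (x n) (y n)) z -> norm z <= s.
Proof.
intros Hs Hz.
assert (H : is_lim_seq (fun n => norm (sum_n (fun n => tens (x n) (y n)) n)) (norm z)).
{ unfold is_lim_seq. eapply filterlim_comp; [exact Hz | apply filterlim_norm]. }
refine (is_lim_seq_le _ _ (Finite _) (Finite _) _ H Hs).
intros n. eapply Rle_trans; [exact (norm_sum_n_m _ 0 n)|].
unfold sum_n. apply sum_n_m_le. intros; apply norm_tens_le.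
Qed.

Lemma approx_step (z : proj_tensor X Y) (A : list (X * Y)) d : 0 < d ->
  exists l, l <> [] /\ norm (minus z (psum (A ++ l))) < d /\
    cost X Y l < norm (minus z (psum A)) + d.
Proof.
intros Hd.
destruct (tensor_incl_dense (minus z (psum A)) (d / 2)) as [v Hv]; [lra|].
destruct (proj_norm_approx X Y v (d / 2)) as [l [Hl Hl']]; [lra|].
exists ((zero, zero) :: l). split; [discriminate|].
assert (E : psum ((zero, zero) :: l) = tensor_incl v).
{ unfold psum. f_equal. rewrite Hl. apply tsum_eq.
  apply (te_app _ _ [(zero, zero)] [] l l); [apply te_zero | apply te_refl]. }
split.
- rewrite psum_app E. apply Rle_lt_trans with (2 := Rlt_trans _ _ _ Hv (Rlt_eps2_eps d Hd)).
  right. unfold minus. rewrite opp_plus. apply (f_equal norm), plus_assoc.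
- simpl. rewrite norm_zero Rmult_0_l Rplus_0_l.
  rewrite -norm_tensor_incl in Hl'.
  assert (aux : forall a b c e, Rabs (a - b) <= c -> c < d / 2 -> e < b + d / 2 ->
    e < a + d).
  { intros a b c e H. apply Rabs_le_between in H. lra. }
  exact (aux _ _ _ _ (norm_triangle_inv (minus z (psum A)) (tensor_incl v)) Hv Hl').
Qed.

Lemma series_norm_approx (z : proj_tensor X Y) eps : 0 < eps ->
  exists (x : nat -> X) (y : nat -> Y) (s : R),
    is_series (fun n => norm (x n) * norm (y n)) s /\
    is_series (fun n => tens (x n) (y n)) z /\ s <= norm z + eps.
Proof.
intros He.
set (d := fun j : nat => eps / 4 * (1 / 2) ^ j).
assert (Hd : forall j, 0 < d j).
{ intros j. apply Rmult_lt_0_compat; [lra | apply pow_lt; lra]. }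
assert (HdS : forall j, d (S j) = d j / 2) by (intros j; unfold d; simpl; field).
set (next := fun A j => proj1_sig
  (constructive_indefinite_description _ (approx_step z A (d j) (Hd j)))).
assert (Hnext : forall A j, next A j <> [] /\
  norm (minus z (psum (A ++ next A j))) < d j /\
  cost X Y (next A j) < norm (minus z (psum A)) + d j).
{ intros A j. unfold next. now destruct (constructive_indefinite_description _ _). }
set (A := fix A j := match j with
  | O => [] | S j => A j ++ next (A j) j end).
assert (AS : forall j, A (S j) = A j ++ next (A j) j) by reflexivity.
assert (Anorm : forall j, norm (minus z (psum (A (S j)))) < d j)
  by (intros j; rewrite AS; apply Hnext).
assert (Acost : forall j, cost X Y (A (S j)) <= norm z + eps - 3 * d j).
{ induction j as [|j IH]; rewrite AS cost_app.
  - destruct (Hnext (A 0%nat) 0%nat) as [_ [_ H]]. revert H.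
    change (A 0%nat) with (@nil (X * Y)). rewrite psum_nil minus_zero_r.
    unfold d. simpl. lra.
  - destruct (Hnext (A (S j)) (S j)) as [_ [_ H]]. pose proof (Anorm j).
    pose proof (HdS j). lra. }
assert (Alen : forall j, (j <= length (A j))%nat).
{ induction j as [|j IH]; [simpl; lia|]. rewrite AS length_app.
  destruct (Hnext (A j) j) as [H _]. destruct (next (A j) j); [easy | simpl; lia]. }
assert (Apre : forall i j n, (i <= j)%nat -> (n < length (A i))%nat ->
  nth n (A j) f0 = nth n (A i) f0 /\ (n < length (A j))%nat).
{ intros i j n Hij Hn. induction Hij as [|j Hij [IH1 IH2]]; [easy|].
  rewrite AS length_app app_nth1; [split; [exact IH1 | lia] | exact IH2]. }
set (f := fun n => nth n (A (S n)) f0).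
assert (Af : forall j n, (n < length (A j))%nat -> f n = nth n (A j) f0).
{ intros j n Hn. unfold f. pose proof (Alen (S n)).
  destruct (Nat.le_ge_cases j (S n)) as [Hj|Hj].
  - now apply Apre.
  - symmetry. apply Apre; [exact Hj | lia]. }
set (phi := fun j => (length (A (S j)) - 1)%nat).
assert (Hphi : forall j, (j <= phi j)%nat)
  by (intros j; unfold phi; pose proof (Alen (S j)); lia).
assert (Ane : forall j, A (S j) <> []).
{ intros j H. pose proof (Alen (S j)) as H'. rewrite H in H'. simpl in H'. lia. }
set (c := fun n => norm (fst (f n)) * norm (snd (f n))).
assert (c0 : forall n, 0 <= c n)
  by (intros n; apply Rmult_le_pos; apply norm_ge_0).
assert (csum : forall j, sum_n c (phi j) = cost X Y (A (S j))).
{ intros j. rewrite -(sum_n_nth (fun q => norm (fst q) * norm (snd q)) (cost X Y)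
    eq_refl) //.
  - apply sum_n_ext_loc. intros n Hn. unfold c. rewrite (Af (S j)) //.
    unfold phi in Hn. pose proof (Alen (S j)). lia.
  - intros l q. rewrite cost_app. simpl. rewrite Rplus_0_r. reflexivity. }
assert (tsumE : forall j,
  sum_n (fun n => tens (fst (f n)) (snd (f n))) (phi j) = psum (A (S j))).
{ intros j. rewrite -(sum_n_nth (fun q => tens (fst q) (snd q)) psum psum_nil) //.
  - apply sum_n_ext_loc. intros n Hn. rewrite (Af (S j)) //.
    unfold phi in Hn. pose proof (Alen (S j)). lia.
  - intros l [x y]. apply psum_app. }
assert (cmono : forall n, sum_n c n <= sum_n c (S n)).
{ intros n. rewrite sum_Sn. pose proof (c0 (S n)). unfold plus; simpl. lra. }
assert (cle : forall n, sum_n c n <= norm z + eps).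
{ intros n. apply Rle_trans with (sum_n c (phi n)).
  - generalize (Hphi n). generalize (phi n). induction 1; [lra|].
    eapply Rle_trans; [eassumption | apply cmono].
  - rewrite csum. pose proof (Acost n). pose proof (Hd n). lra. }
destruct (ex_finite_lim_seq_incr _ _ cmono cle) as [s Hs].
exists (fun n => fst (f n)), (fun n => snd (f n)), s.
split; [exact Hs|]. split.
- destruct (ex_series_le (fun n => tens (fst (f n)) (snd (f n))) c) as [w Hw].
  { intros n. apply norm_tens_le. }
  { now exists s. }
  enough (E : w = z) by (rewrite -E; exact Hw).
  apply (filterlim_locally_unique (F := eventually) (fun j => psum (A (S j)))).
  + apply filterlim_ext with
      (fun j => sum_n (fun n => tens (fst (f n)) (snd (f n))) (phi j)); [exact tsumE|].
    eapply filterlim_comp; [|exact Hw].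
    intros P [N HN]. exists N. intros n Hn. apply HN. pose proof (Hphi n). lia.
  + apply filterlim_locally. intros e.
    assert (Hlim : is_lim_seq d 0).
    { replace (Finite 0) with (Rbar_mult (eps / 4) 0) by (simpl; f_equal; ring).
      apply is_lim_seq_scal_l, is_lim_seq_geom. rewrite Rabs_pos_eq; lra. }
    apply is_lim_seq_spec in Hlim. destruct (Hlim e) as [N HN].
    exists N. intros n Hn. apply norm_compat1. rewrite -opp_minus norm_opp.
    specialize (HN n Hn). rewrite Rminus_0_r Rabs_pos_eq in HN;
      [exact (Rlt_trans _ _ _ (Anorm n) HN) | apply Rlt_le, Hd].
- exact (is_lim_seq_le _ _ (Finite _) (Finite _) cle Hs (is_lim_seq_const _)).
Qed.

Theorem proj_norm_series (z : proj_tensor X Y) :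
  is_glb_Rbar (fun s => exists (x : nat -> X) (y : nat -> Y),
    is_series (fun n => norm (x n) * norm (y n)) s /\
    is_series (fun n => tens (x n) (y n)) z) (norm z).
Proof.
split.
- intros s (x & y & Hs & Hz). exact (series_norm_ge z x y s Hs Hz).
- intros b Hb.
  assert (H : forall eps, 0 < eps -> Rbar_le b (norm z + eps)).
  { intros eps He. destruct (series_norm_approx z eps He) as (x & y & s & Hs & Hz & Hle).
    apply Rbar_le_trans with (Finite s); [|exact Hle]. apply Hb. now exists x, y. }
  destruct b as [b| |]; simpl in *; [|exact (H 1 Rlt_0_1)|exact I].
  apply le_epsilon. exact H.
Qed.

End Projective.

Section Forms.
Context {k : RC} (X Y : NormedModule k).

Record is_bilinear_form (B : X -> Y -> k) : Prop := {
  form_plus_l : forall x x' y, B (plus x x') y = plus (B x y) (B x' y);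
  form_plus_r : forall x y y', B x (plus y y') = plus (B x y) (B x y');
  form_scal_l : forall (c : k) x y, B (scal c x) y = mult c (B x y);
  form_scal_r : forall (c : k) x y, B x (scal c y) = mult c (B x y) }.

Definition bounded_form (B : X -> Y -> k) : Prop :=
  exists M, forall x y, abs (B x y) <= M * norm x * norm y.

(* The supremum is over pairs of unit vectors, so no [m] qualifies when X or Y
   is the zero space: the set is then empty and [is_lub] fails. *)
Definition is_form_norm (B : X -> Y -> k) (m : R) : Prop :=
  is_lub (fun r => exists x y, norm x = 1 /\ norm y = 1 /\ r = abs (B x y)) m.

Definition property_Loo : Prop :=
  forall eps, 0 < eps ->
  forall B, is_bilinear_form B -> bounded_form B -> is_form_norm B 1 ->
  exists eta, 0 < eta /\
    forall x y, norm x = 1 -> norm y = 1 -> abs (B x y) > 1 - eta ->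
    exists x0 y0, norm x0 = 1 /\ norm y0 = 1 /\ abs (B x0 y0) = 1 /\
      norm (minus x x0) < eps /\ norm (minus y y0) < eps.

End Forms.

Definition closure {K : AbsRing} {V : NormedModule K} (A : V -> Prop) (z : V) : Prop :=
  forall eps, 0 < eps -> exists w, A w /\ norm (minus z w) < eps.

(* Main.v *)
Require Import Defs.
From Stdlib Require Import Reals Lra Lia List Classical ssreflect.
From mathcomp Require boolp classical_sets.
From Coquelicot Require Import Coquelicot.
Import ListNotations.
Open Scope R_scope.

(** The algebraic tensors are dense, so let [t] be one, with [N = proj_norm t > 0].
    By the Hahn-Banach theorem ([hahn_banach]) there is a linear functional [phi]
    on the tensor product with [|phi| <= proj_norm] and [re (phi t) = N]. Its
    bilinear form [B x y = phi (x (x) y)] has norm one ([functional_form_norm]), so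
    the hypothesis provides, for a precision of order [rho], a threshold [eta].

    Take a representation [t = sum x_i (x) y_i] whose cost [sum |x_i| |y_i|] is less
    than [N + gamma]. The defects [|x_i| |y_i| - re (B x_i y_i)] are nonnegative and
    their sum is less than [gamma]. If the defect of a term is less than [eta] times
    its size, the normalised pair is close to a pair of unit vectors at which [|B|]
    equals 1; after a rotation by a scalar close to 1 this yields a nearby
    elementary tensor on which [phi] equals the cost ([unit_replacement]). The other
    terms have total size at most [gamma / eta] and are dropped. Since [gamma] is
    chosen after [eta], the sum [w] of the new terms is close to [t]
    ([tsum_replacement]). On [w] the functional [phi] equals the cost of the given
    representation, so this cost is at most, hence equal to, the norm of [w].

    The Hahn-Banach theorem is obtained without extending partially defined
    functionals: by Zorn's lemma there is a minimal sublinear functional below a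
    given one, and minimality makes it linear ([hahn_banach_sublinear]). *)

(** * Scalars of a real or complex normed space *)

Section Scalars.
Context {k : RC}.

Definition of_real (r : R) : k :=
  match k return scalars k with Real => r | Complex => RtoC r end.

Definition re (a : k) : R :=
  match k return scalars k -> R with Real => fun a => a | Complex => Re end a.

Lemma of_real_one : of_real 1 = one.
Proof. now unfold of_real; destruct k. Qed.

Lemma of_real_plus r s : of_real (r + s) = plus (of_real r) (of_real s).
Proof. unfold of_real; destruct k; [reflexivity | exact (RtoC_plus r s)]. Qed.

Lemma of_real_mult r s : of_real (r * s) = mult (of_real r) (of_real s).
Proof. unfold of_real; destruct k; [reflexivity | exact (RtoC_mult r s)]. Qed.

Lemma of_real_opp_one : of_real (-1) = opp one.
Proof. unfold of_real; destruct k; [reflexivity | exact (RtoC_opp 1)]. Qed.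

Lemma abs_of_real r : abs (of_real r) = Rabs r.
Proof. unfold of_real; destruct k; [reflexivity | exact (Cmod_R r)]. Qed.

Lemma re_add (a b : k) : re (plus a b) = re a + re b.
Proof. unfold re; destruct k; reflexivity. Qed.

Lemma re_of_real_mult r (a : k) : re (mult (of_real r) a) = r * re a.
Proof. unfold re, of_real; destruct k; [reflexivity | exact (re_scal_l r a)]. Qed.

Lemma re_one : re one = 1.
Proof. unfold re; destruct k; reflexivity. Qed.

Lemma re_le_abs (a : k) : re a <= abs a.
Proof.
unfold re; destruct k; [apply Rle_abs|].
exact (Rle_trans _ _ _ (Rle_abs (Re a)) (re_le_Cmod a)).
Qed.

(** In the unit disc, [|a - 1|^2 = |a|^2 + 1 - 2 re a <= 2 (1 - re a)]. *)
Lemma abs_minus_one_le (a : k) d : 0 <= d -> abs a <= 1 ->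
  1 - d ^ 2 / 2 < re a -> abs (minus a one) <= d.
Proof.
intros Hd Ha Hre. unfold re in Hre.
destruct k.
- change (Rabs (a - 1) <= d). change (Rabs a <= 1) in Ha.
  change R in a. apply Rabs_le_between in Ha. apply Rabs_le.
  split; nra.
- change (Cmod (a - 1)%C <= d). change (Cmod a <= 1) in Ha.
  change C in a. apply Rsqr_incr_0_var; [|exact Hd]. unfold Rsqr.
  pose proof (Cmod2_alt (a - 1)%C) as E. pose proof (Cmod2_alt a) as E'.
  pose proof (Cmod_ge_0 a). destruct a as [a b]. simpl in *. nra.
Qed.

(** For nonzero [a] take the conjugate of [a] divided by its modulus. *)
Lemma rotation_exists (a : k) : exists theta : k, abs theta <= 1 /\
  mult theta a = of_real (abs a).
Proof.
unfold of_real. destruct k.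
- change R in a. exists (sign a). change (Rabs (sign a) <= 1 /\ sign a * a = Rabs a).
  split.
  + destruct (Rtotal_order a 0) as [H|[H|H]].
    * rewrite sign_eq_m1 // Rabs_Ropp Rabs_R1; lra.
    * rewrite H sign_0 Rabs_R0; lra.
    * rewrite sign_eq_1 // Rabs_R1; lra.
  + destruct (Rtotal_order a 0) as [H|[H|H]].
    * rewrite sign_eq_m1 // Rabs_left //; lra.
    * rewrite H sign_0 Rabs_R0; lra.
    * rewrite sign_eq_1 // Rabs_right; lra.
- change C in a.
  destruct (classic (a = 0%C)) as [->|Ha].
  + exists (zero : C_AbsRing). split.
    * rewrite (abs_zero (K := C_AbsRing)). lra.
    * change (0 * 0 = Cmod 0)%C. rewrite Cmod_0. ring.
  + assert (Hm : 0 < Cmod a) by now apply Cmod_gt_0.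
    exists (Cconj a / Cmod a)%C.
    change (Cmod (Cconj a / Cmod a)%C <= 1 /\ (Cconj a / Cmod a * a)%C = Cmod a).
    assert (Hc : RtoC (Cmod a) <> 0%C) by (intros H; apply RtoC_inj in H; lra).
    split.
    * rewrite Cmod_div // Cmod_conj Cmod_R Rabs_pos_eq; [|lra]. right. field. lra.
    * transitivity ((a * Cconj a) / Cmod a)%C; [now field|].
      rewrite -Cmod2_conj. simpl. rewrite Rmult_1_r RtoC_mult. now field.
Qed.

End Scalars.

(** * The Hahn-Banach theorem for seminorms *)

Lemma zorn_preorder (T : Type) (t0 : T) (le : T -> T -> Prop) :
  (forall t, le t t) -> (forall r s t, le r s -> le s t -> le r t) ->
  (forall A : T -> Prop, (forall s t, A s -> A t -> le s t \/ le t s) ->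
    exists t, forall s, A s -> le s t) ->
  exists t, forall s, le t s -> le s t.
Proof.
intros Hrefl Htrans Hchain.
assert (E : forall s t, is_true (boolp.asbool (le s t)) = le s t)
  by (intros s t; apply boolp.asboolE).
destruct (@classical_sets.ZL_preorder T t0 (fun s t => boolp.asbool (le s t)))
  as [t Ht].
- intros t. now rewrite E.
- intros r s t. rewrite !E. apply Htrans.
- intros A HA. destruct (Hchain A) as [t Ht].
  + intros s t Hs Ht. specialize (HA s t Hs Ht). now rewrite !E in HA.
  + exists t. intros s Hs. rewrite E. now apply Ht.
- exists t. intros s. specialize (Ht s). now rewrite !E in Ht.
Qed.

Lemma Glb_Rbar_finite (E : R -> Prop) a b : E a -> (forall r, E r -> b <= r) ->
  is_glb_Rbar E (real (Glb_Rbar E)).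
Proof.
intros Ha Hb. pose proof (Glb_Rbar_correct E) as H.
destruct (Glb_Rbar E) as [g| |]; [exact H| |]; exfalso; destruct H as [Hl Hg].
- exact (Hl a Ha).
- exact (Hg (Finite b) Hb).
Qed.

Section Sublinear.
Context {k : RC} {V : ModuleSpace k}.

Local Notation "r *: v" := (scal (of_real r : k) v) (at level 40).

(** The second clause is an inequality because this form passes to infima;
    applying it to the inverse of [r] gives equality. *)
Record sublinear (q : V -> R) : Prop := {
  sublinear_plus : forall u v, q (plus u v) <= q u + q v;
  sublinear_scal : forall r v, 0 < r -> q (r *: v) <= r * q v }.

Lemma real_scal_assoc r s (v : V) : r *: (s *: v) = (r * s) *: v.
Proof. rewrite of_real_mult. exact (scal_assoc (of_real r) (of_real s) v). Qed.

Lemma real_scal_one (v : V) : 1 *: v = v.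
Proof. rewrite of_real_one. exact (scal_one v). Qed.

Lemma real_scal_opp r (v : V) : r *: opp v = opp (r *: v).
Proof. exact (scal_opp_r (of_real r) v). Qed.

Lemma real_scal_plus_l r s (v : V) : (r + s) *: v = plus (r *: v) (s *: v).
Proof. rewrite of_real_plus. exact (scal_distr_r (of_real r) (of_real s) v). Qed.

Lemma real_scal_plus_r r (u v : V) : r *: (plus u v) = plus (r *: u) (r *: v).
Proof. exact (scal_distr_l (of_real r) u v). Qed.

Section OneSublinear.
Context {q : V -> R} (Hq : sublinear q).

Lemma sublinear_scal_ge r v : 0 < r -> r * q v <= q (r *: v).
Proof.
intros Hr. pose proof (Rinv_0_lt_compat r Hr) as Hr'.
pose proof (sublinear_scal q Hq (/ r) (r *: v) Hr') as H.
rewrite real_scal_assoc Rinv_l in H; [|lra]. rewrite real_scal_one in H.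
apply (Rmult_le_compat_l r) in H; [|lra].
rewrite -Rmult_assoc Rinv_r in H; lra.
Qed.

Lemma sublinear_zero : q zero = 0.
Proof.
pose proof (sublinear_scal q Hq 2 zero ltac:(lra)) as H2.
pose proof (sublinear_scal q Hq (/ 2) zero ltac:(lra)) as H1.
assert (Z : forall r, r *: zero = (zero : V))
  by (intros r; exact (scal_zero_r (of_real r))).
rewrite Z in H1. rewrite Z in H2. lra.
Qed.

Lemma sublinear_opp_ge v : - q (opp v) <= q v.
Proof.
pose proof (sublinear_plus q Hq v (opp v)) as H.
rewrite plus_opp_r sublinear_zero in H. lra.
Qed.

(** The one-sided derivative of [q] at [y] in the direction [x]: the expression
    below is the difference quotient for the increment [x / s]. As a function of
    [x] it is again sublinear and lies below [q], and at [- y] it is at most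
    [- q y]. *)
Definition tilt (y x : V) : R :=
  real (Glb_Rbar (fun r => exists s, 0 < s /\ r = q (plus x (s *: y)) - s * q y)).

Lemma tilt_glb y x : is_glb_Rbar
  (fun r => exists s, 0 < s /\ r = q (plus x (s *: y)) - s * q y) (tilt y x).
Proof.
apply (Glb_Rbar_finite _ (q (plus x (1 *: y)) - 1 * q y) (- q (opp x))).
- exists 1. split; [lra | reflexivity].
- intros r [s [Hs ->]].
  pose proof (sublinear_plus q Hq (opp x) (plus x (s *: y))) as H.
  rewrite plus_assoc plus_opp_l plus_zero_l in H.
  pose proof (sublinear_scal_ge s y Hs). lra.
Qed.

Lemma tilt_le y x s : 0 < s -> tilt y x <= q (plus x (s *: y)) - s * q y.
Proof. intros Hs. apply (proj1 (tilt_glb y x)). now exists s. Qed.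

Lemma tilt_ge y x b :
  (forall s, 0 < s -> b <= q (plus x (s *: y)) - s * q y) -> b <= tilt y x.
Proof.
intros H. apply (proj2 (tilt_glb y x) (Finite b)).
intros r [s [Hs ->]]. now apply H.
Qed.

Lemma tilt_le_self y x : tilt y x <= q x.
Proof.
pose proof (tilt_le y x 1 ltac:(lra)).
pose proof (sublinear_plus q Hq x (1 *: y)).
pose proof (sublinear_scal q Hq 1 y ltac:(lra)). lra.
Qed.

Lemma tilt_opp y : tilt y (opp y) <= - q y.
Proof.
pose proof (tilt_le y (opp y) 1 ltac:(lra)) as H.
rewrite real_scal_one plus_opp_l sublinear_zero in H. lra.
Qed.

Lemma tilt_sublinear y : sublinear (tilt y).
Proof.
split.
- intros u v.
  enough (tilt y (plus u v) - tilt y v <= tilt y u) by lra.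
  apply tilt_ge; intros s Hs.
  enough (tilt y (plus u v) - (q (plus u (s *: y)) - s * q y) <= tilt y v) by lra.
  apply tilt_ge; intros s' Hs'.
  pose proof (tilt_le y (plus u v) (s + s') ltac:(lra)) as H.
  pose proof (sublinear_plus q Hq (plus u (s *: y)) (plus v (s' *: y))) as H'.
  replace (plus (plus u (s *: y)) (plus v (s' *: y)))
    with (plus (plus u v) ((s + s') *: y)) in H'; [lra|].
  rewrite real_scal_plus_l -!plus_assoc. f_equal.
  rewrite !plus_assoc. f_equal. apply plus_comm.
- intros r v Hr.
  enough (H : / r * tilt y (r *: v) <= tilt y v).
  { apply (Rmult_le_compat_l r) in H; [|lra].
    rewrite -Rmult_assoc Rinv_r in H; lra. }
  apply tilt_ge; intros s Hs.
  pose proof (tilt_le y (r *: v) (r * s) ltac:(nra)) as H.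
  rewrite -real_scal_assoc -real_scal_plus_r in H.
  pose proof (sublinear_scal q Hq r (plus v (s *: y)) Hr) as H'.
  apply (Rmult_le_reg_l r); [lra|]. rewrite -Rmult_assoc Rinv_r; lra.
Qed.

End OneSublinear.

Lemma chain_inf_sublinear (A : (V -> R) -> Prop) (p : V -> R) :
  (exists q, A q) -> (forall q, A q -> sublinear q /\ forall v, q v <= p v) ->
  (forall q q', A q -> A q' -> (forall v, q v <= q' v) \/ (forall v, q' v <= q v)) ->
  exists m, sublinear m /\ forall q, A q -> forall v, m v <= q v.
Proof.
intros [q0 Hq0] HA Hchain.
set (E := fun (v : V) r => exists q, A q /\ r = q v).
assert (HE : forall v, is_glb_Rbar (E v) (real (Glb_Rbar (E v)))).
{ intros v. apply (Glb_Rbar_finite _ (q0 v) (- p (opp v))); [now exists q0|].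
  intros r [q [Hq ->]]. destruct (HA q Hq) as [Hs Hp].
  pose proof (sublinear_opp_ge Hs v). specialize (Hp (opp v)). lra. }
set (m := fun v => real (Glb_Rbar (E v))).
assert (mle : forall q v, A q -> m v <= q v).
{ intros q v Hq. apply (proj1 (HE v)). now exists q. }
assert (mge : forall b v, (forall q, A q -> b <= q v) -> b <= m v).
{ intros b v H. apply (proj2 (HE v) (Finite b)). intros r [q [Hq ->]]. now apply H. }
exists m. split; [split|intros; now apply mle].
- intros u v. enough (m (plus u v) - m v <= m u) by lra.
  apply mge; intros q Hq. enough (m (plus u v) - q u <= m v) by lra.
  apply mge; intros q' Hq'.
  (* the smaller of the two functionals bounds both summands *)
  destruct (Hchain q q' Hq Hq') as [H|H].
  + pose proof (mle q (plus u v) Hq). specialize (H v).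
    pose proof (sublinear_plus q (proj1 (HA q Hq)) u v). lra.
  + pose proof (mle q' (plus u v) Hq'). specialize (H u).
    pose proof (sublinear_plus q' (proj1 (HA q' Hq')) u v). lra.
- intros r v Hr. enough (H : / r * m (r *: v) <= m v).
  { apply (Rmult_le_compat_l r) in H; [|lra].
    rewrite -Rmult_assoc Rinv_r in H; lra. }
  apply mge; intros q Hq. pose proof (mle q (r *: v) Hq).
  pose proof (sublinear_scal q (proj1 (HA q Hq)) r v Hr).
  apply (Rmult_le_reg_l r); [lra|]. rewrite -Rmult_assoc Rinv_r; lra.
Qed.

Lemma minimal_sublinear_exists (p : V -> R) : sublinear p ->
  exists q, sublinear q /\ (forall v, q v <= p v) /\
    forall q', sublinear q' -> (forall v, q' v <= q v) -> forall v, q v <= q' v.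
Proof.
intros Hp.
set (T := {q : V -> R | sublinear q /\ forall v, q v <= p v}).
assert (Hpp : sublinear p /\ forall v, p v <= p v) by (split; [exact Hp | intros; lra]).
destruct (zorn_preorder T (exist _ p Hpp)
  (fun a b => forall v, proj1_sig b v <= proj1_sig a v)) as [[q [Hq Hqp]] Hmin].
- intros t v. lra.
- intros r s t H1 H2 v. specialize (H1 v). specialize (H2 v). lra.
- intros A HA. destruct (classic (exists t, A t)) as [[t0 Ht0]|Hn].
  + destruct (chain_inf_sublinear (fun q => exists t, A t /\ q = proj1_sig t) p)
      as [m [Hm Hle]].
    * now exists (proj1_sig t0), t0.
    * intros q [t [Ht ->]]. exact (proj2_sig t).
    * intros q q' [t [Ht ->]] [t' [Ht' ->]].
      destruct (HA t t' Ht Ht') as [H|H]; [right | left]; exact H.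
    * assert (Hmp : sublinear m /\ forall v, m v <= p v).
      { split; [exact Hm|]. intros v.
        apply Rle_trans with (proj1_sig t0 v); [|apply (proj2_sig t0)].
        apply Hle. now exists t0. }
      exists (exist _ m Hmp). intros s Hs v. apply Hle. now exists s.
  + exists (exist _ p Hpp). intros s Hs. exfalso. apply Hn. now exists s.
- exists q. split; [exact Hq|]. split; [exact Hqp|].
  intros q' Hq' Hle.
  assert (H : sublinear q' /\ forall v, q' v <= p v).
  { split; [exact Hq'|]. intros v. exact (Rle_trans _ _ _ (Hle v) (Hqp v)). }
  exact (Hmin (exist _ q' H) Hle).
Qed.

(** A minimal sublinear functional equals all its tilts, so it is odd, and an odd
    sublinear functional is linear. Starting from the tilt of [p] along [t]
    forces the value [p t] at [t]. *)
Theorem hahn_banach_sublinear (p : V -> R) (t : V) : sublinear p ->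
  exists f : V -> R, (forall u v, f (plus u v) = f u + f v) /\
    (forall r v, f (r *: v) = r * f v) /\ (forall v, f v <= p v) /\ p t <= f t.
Proof.
intros Hp.
destruct (minimal_sublinear_exists _ (tilt_sublinear Hp t)) as (f & Hf & Hle & Hmin).
assert (Hodd : forall v : V, f (opp v) = - f v).
{ intros v. apply Rle_antisym.
  - eapply Rle_trans; [|apply (tilt_opp Hf)].
    apply Hmin; [apply (tilt_sublinear Hf) | apply (tilt_le_self Hf)].
  - pose proof (sublinear_opp_ge Hf v). lra. }
assert (Hpos : forall r v, 0 < r -> f (r *: v) = r * f v).
{ intros r v Hr. apply Rle_antisym; [now apply (sublinear_scal f Hf)|].
  now apply (sublinear_scal_ge Hf). }
exists f. split; [|split; [|split]].
- intros u v. apply Rle_antisym; [apply (sublinear_plus f Hf)|].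
  assert (H : f (opp (plus u v)) <= f (opp u) + f (opp v))
    by (rewrite opp_plus; apply (sublinear_plus f Hf)).
  rewrite !Hodd in H. lra.
- intros r v. destruct (Rtotal_order r 0) as [Hr|[Hr|Hr]]; [| |now apply Hpos].
  + replace (r *: v) with (opp ((- r) *: v)).
    * rewrite Hodd Hpos; [ring | lra].
    * rewrite -real_scal_opp -(scal_opp_one v) -of_real_opp_one real_scal_assoc.
      now replace (- r * -1) with r by ring.
  + rewrite Hr Rmult_0_l. etransitivity; [|exact (sublinear_zero Hf)]. f_equal.
    apply (plus_reg_l (1 *: v)). rewrite -real_scal_plus_l Rplus_0_r plus_zero_r //.
- intros v. eapply Rle_trans; [apply Hle | apply (tilt_le_self Hp)].
- pose proof (Hle (opp t)) as H. pose proof (tilt_opp Hp t). rewrite Hodd in H. lra.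
Qed.

Record linear_functional (phi : V -> k) : Prop := {
  functional_plus : forall u v, phi (plus u v) = plus (phi u) (phi v);
  functional_scal : forall (c : k) v, phi (scal c v) = mult c (phi v) }.

End Sublinear.

(** Over the complex numbers [f] is the real part of [f v - i f (i v)]. *)
Lemma complexification {k : RC} {V : ModuleSpace k} (f : V -> R) :
  (forall u v, f (plus u v) = f u + f v) ->
  (forall r v, f (scal (of_real r : k) v) = r * f v) ->
  exists phi : V -> k, linear_functional phi /\ forall v, re (phi v) = f v.
Proof.
unfold re, of_real. destruct k; intros Hplus Hscal.
- exists f. split; [|reflexivity]. split; [exact Hplus | exact Hscal].
- exists (fun v => (f v, - f (scal (Ci : C_AbsRing) v))). split; [|reflexivity].
  split.
  + intros u v.
    rewrite (scal_distr_l (Ci : C_AbsRing) u v) !Hplus.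
    apply (f_equal2 (@pair R R)); [reflexivity|]. simpl. unfold plus; simpl. ring.
  + intros [a b] v. change R in a, b.
    assert (E : scal ((a, b) : C_AbsRing) v
      = plus (scal (RtoC a : C_AbsRing) v)
          (scal (RtoC b : C_AbsRing) (scal (Ci : C_AbsRing) v))).
    { etransitivity; [|apply (f_equal (plus _));
        exact (eq_sym (scal_assoc (RtoC b : C_AbsRing) (Ci : C_AbsRing) v))].
      etransitivity; [|exact (scal_distr_r (RtoC a : C_AbsRing) _ v)].
      apply (f_equal (fun c : C_AbsRing => scal c v)).
      unfold plus, mult; simpl. unfold Cplus, Cmult; simpl. f_equal; ring. }
    assert (E' : scal (Ci : C_AbsRing) (scal ((a, b) : C_AbsRing) v)
      = plus (scal (RtoC a : C_AbsRing) (scal (Ci : C_AbsRing) v))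
          (scal (RtoC (- b) : C_AbsRing) v)).
    { etransitivity; [exact (scal_assoc (Ci : C_AbsRing) _ v)|].
      etransitivity; [|apply (f_equal (fun w => plus w _));
        exact (eq_sym (scal_assoc (RtoC a : C_AbsRing) (Ci : C_AbsRing) v))].
      etransitivity; [|exact (scal_distr_r _ (RtoC (- b) : C_AbsRing) v)].
      apply (f_equal (fun c : C_AbsRing => scal c v)).
      unfold plus, mult; simpl. unfold Cplus, Cmult; simpl. f_equal; ring. }
    rewrite E' E !Hplus !Hscal.
    unfold mult; simpl. unfold Cmult; simpl. f_equal; ring.
Qed.

(** Rotating the argument turns the bound on the real part into a bound on the
    modulus. *)
Theorem hahn_banach {k : RC} {V : ModuleSpace k} (p : V -> R) (t : V) :
  is_seminorm p ->
  exists phi : V -> k, linear_functional phi /\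
    (forall v, abs (phi v) <= p v) /\ p t <= re (phi t).
Proof.
intros Hp.
destruct (hahn_banach_sublinear p t) as (f & Hplus & Hscal & Hle & Ht).
{ split; [apply (seminorm_triangle _ Hp)|]. intros r v Hr.
  eapply Rle_trans; [apply (seminorm_scal _ Hp)|]. rewrite abs_of_real Rabs_pos_eq; lra. }
destruct (complexification f Hplus Hscal) as (phi & Hphi & Hre).
exists phi. split; [exact Hphi|]. split; [|now rewrite Hre].
intros v. destruct (rotation_exists (phi v)) as (theta & Habs & Hrot).
assert (E : re (phi (scal theta v)) = abs (phi v)).
{ rewrite (functional_scal _ Hphi) Hrot -(Rmult_1_r (abs (phi v))) of_real_mult.
  rewrite re_of_real_mult of_real_one re_one. ring. }
rewrite -E Hre. eapply Rle_trans; [apply Hle|].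
eapply Rle_trans; [apply (seminorm_scal _ Hp)|].
pose proof (p_ge0 V p Hp v). nra.
Qed.

(** * Elementary tensors *)

Section Elementary.
Context {k : RC} {X Y : NormedModule k}.

Definition elem (x : X) (y : Y) : tensor X Y := tsum X Y [(x, y)].

Lemma elem_plus_l x x' y : elem (plus x x') y = plus (elem x y) (elem x' y).
Proof.
etransitivity; [apply tsum_eq, te_plus_l | exact (tsum_app X Y [(x, y)] [(x', y)])].
Qed.

Lemma elem_plus_r x y y' : elem x (plus y y') = plus (elem x y) (elem x y').
Proof.
etransitivity; [apply tsum_eq, te_plus_r | exact (tsum_app X Y [(x, y)] [(x, y')])].
Qed.

Lemma elem_scal_l (c : k) x y : elem (scal c x) y = scal c (elem x y).
Proof. exact (tsum_lscal X Y c [(x, y)]). Qed.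

Lemma elem_scal_r (c : k) x y : elem x (scal c y) = scal c (elem x y).
Proof. rewrite -elem_scal_l. apply tsum_eq, te_sym, te_scal. Qed.

Lemma elem_minus_l x x' y : minus (elem x y) (elem x' y) = elem (minus x x') y.
Proof.
unfold minus. rewrite elem_plus_l. f_equal.
rewrite -(scal_opp_one x') elem_scal_l. symmetry. exact (scal_opp_one (elem x' y)).
Qed.

Lemma elem_minus_r x y y' : minus (elem x y) (elem x y') = elem x (minus y y').
Proof.
unfold minus. rewrite elem_plus_r. f_equal.
rewrite -(scal_opp_one y') elem_scal_r. symmetry. exact (scal_opp_one (elem x y')).
Qed.

Lemma tsum_cons x y l : tsum X Y ((x, y) :: l) = plus (elem x y) (tsum X Y l).
Proof. exact (tsum_app X Y [(x, y)] l). Qed.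

Lemma proj_norm_elem_le x y : proj_norm X Y (elem x y) <= norm x * norm y.
Proof. pose proof (proj_norm_le X Y [(x, y)]) as H. simpl in H. unfold elem. lra. Qed.

Lemma norm_scal_real_le {Z : NormedModule k} r (v : Z) : 0 <= r ->
  norm (scal (of_real r) v) <= r * norm v.
Proof.
intros Hr. eapply Rle_trans; [apply norm_scal|].
rewrite abs_of_real Rabs_pos_eq; lra.
Qed.

Lemma polar_decomposition {Z : NormedModule k} (v : Z) : 0 < norm v ->
  exists u : Z, norm u = 1 /\ v = scal (of_real (norm v)) u.
Proof.
intros Hv. pose proof (Rinv_0_lt_compat _ Hv) as Hi.
set (u := scal (of_real (/ norm v) : k) v).
assert (E : v = scal (of_real (norm v)) u).
{ unfold u. rewrite real_scal_assoc Rinv_r; [|lra]. now rewrite real_scal_one. }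
exists u. split; [|exact E].
apply Rle_antisym.
- pose proof (norm_scal_real_le (/ norm v) v ltac:(lra)) as H.
  rewrite Rinv_l in H; [exact H | lra].
- pose proof (norm_scal_real_le (norm v) u ltac:(lra)) as H. rewrite -E in H.
  apply (Rmult_le_reg_l (norm v)); lra.
Qed.

Lemma elem_polar (x : X) (y : Y) : 0 < norm x * norm y ->
  exists (x1 : X) (y1 : Y), norm x1 = 1 /\ norm y1 = 1 /\
    elem x y = scal (of_real (norm x * norm y)) (elem x1 y1).
Proof.
intros Hc. pose proof (norm_ge_0 x). pose proof (norm_ge_0 y).
destruct (polar_decomposition x) as (x1 & Hx1 & Ex); [nra|].
destruct (polar_decomposition y) as (y1 & Hy1 & Ey); [nra|].
exists x1, y1. split; [exact Hx1|]. split; [exact Hy1|].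
rewrite {1}Ex {1}Ey elem_scal_l elem_scal_r. apply real_scal_assoc.
Qed.

Lemma proj_norm_unit_perturbation (x x0 : X) (y y0 : Y) (theta : k) d :
  norm y = 1 -> norm x0 = 1 -> norm y0 = 1 ->
  norm (minus x x0) <= d -> norm (minus y y0) <= d ->
  proj_norm X Y (minus (elem x y) (scal theta (elem x0 y0)))
    <= 2 * d + abs (minus one theta).
Proof.
intros Hy Hx0 Hy0 Hx Hyd.
pose proof (proj_norm_seminorm X Y) as Hp.
assert (E : minus (elem x0 y0) (scal theta (elem x0 y0))
  = scal (minus one theta) (elem x0 y0)).
{ rewrite scal_minus_distr_r. f_equal. symmetry. exact (scal_one (elem x0 y0)). }
rewrite (minus_trans (elem x0 y)) elem_minus_l.
rewrite (minus_trans (elem x0 y0)) elem_minus_r E.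
eapply Rle_trans; [apply (seminorm_triangle _ Hp)|].
eapply Rle_trans; [apply Rplus_le_compat_l, (seminorm_triangle _ Hp)|].
pose proof (proj_norm_elem_le (minus x x0) y) as H1. rewrite Hy in H1.
pose proof (proj_norm_elem_le x0 (minus y y0)) as H2. rewrite Hx0 in H2.
pose proof (seminorm_scal _ Hp (minus one theta) (elem x0 y0)) as H3.
pose proof (proj_norm_elem_le x0 y0) as H4. rewrite Hx0 Hy0 in H4.
pose proof (abs_ge_0 (minus one theta)). nra.
Qed.

(** * Tensors whose norm is attained by a finite sum *)

Lemma is_series_list {K : AbsRing} {V : NormedModule K} {T : Type} (g : T -> V)
  (d : T) l : g d = zero ->
  is_series (fun n => g (nth n l d))
    (fold_right (fun q s => plus (g q) s) zero l).
Proof.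
intros H0. induction l as [|q l IH]; simpl.
- unfold is_series. apply filterlim_ext with (fun _ : nat => (zero : V)).
  + intros n. induction n as [|n IH]; [now rewrite sum_O | ].
    rewrite sum_Sn -IH H0. now rewrite plus_zero_l.
  + apply filterlim_const.
- apply is_series_decr_1. simpl.
  rewrite (plus_comm (g q)) -plus_assoc plus_opp_r plus_zero_r. exact IH.
Qed.

Lemma attains_proj_norm_tsum l : cost X Y l <= proj_norm X Y (tsum X Y l) ->
  attains_proj_norm (tensor_incl (tsum X Y l)).
Proof.
intros Hl.
exists (fun n => fst (nth n l (zero, zero))), (fun n => snd (nth n l (zero, zero))).
split; [|split].
- clear Hl. induction l as [|[x y] l [M HM]].
  + exists 0. intros [|n]; simpl; rewrite !norm_zero; lra.
  + exists (Rmax M (Rmax (norm x) (norm y))).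
    intros [|n]; split; simpl.
    * exact (Rle_trans _ _ _ (Rmax_l (norm x) (norm y)) (Rmax_r M _)).
    * exact (Rle_trans _ _ _ (Rmax_r (norm x) (norm y)) (Rmax_r M _)).
    * exact (Rle_trans _ _ _ (proj1 (HM n)) (Rmax_l M _)).
    * exact (Rle_trans _ _ _ (proj2 (HM n)) (Rmax_l M _)).
- assert (E : tensor_incl (tsum X Y l)
    = fold_right (fun q s => plus (tens (fst q) (snd q)) s) zero l).
  { clear Hl. induction l as [|[x y] l IH]; [reflexivity|].
    rewrite tsum_cons tensor_incl_plus IH. reflexivity. }
  rewrite E. apply (is_series_list (fun q => tens (fst q) (snd q)) (zero, zero)).
  simpl. unfold tens. transitivity (tensor_incl (tsum X Y [])); [|reflexivity].
  f_equal. apply tsum_eq, te_zero.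
- rewrite norm_tensor_incl.
  replace (proj_norm X Y (tsum X Y l)) with (cost X Y l).
  + apply (is_series_list (V := R_NormedModule)
      (fun q => norm (fst q) * norm (snd q)) (zero, zero)).
    simpl. rewrite norm_zero. exact (Rmult_0_l _).
  + apply Rle_antisym; [exact Hl | apply proj_norm_le].
Qed.

End Elementary.

(** * Replacing a representation by one of minimal cost *)

Section Replacement.
Context {k : RC} {X Y : NormedModule k}.
Context (phi : tensor X Y -> k) (Hphi : linear_functional phi).
Context (phi_le : forall t, abs (phi t) <= proj_norm X Y t).

Lemma functional_minus s t : phi (minus s t) = minus (phi s) (phi t).
Proof.
unfold minus. rewrite (functional_plus _ Hphi). f_equal.
rewrite -(scal_opp_one t) (functional_scal _ Hphi).
exact (scal_opp_one (V := Ring_ModuleSpace k) (phi t)).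
Qed.

Lemma re_functional_real_scal r t : re (phi (scal (of_real r) t)) = r * re (phi t).
Proof. rewrite (functional_scal _ Hphi). apply re_of_real_mult. Qed.

Lemma re_functional_nil : re (phi (tsum X Y [])) = 0.
Proof.
assert (E : tsum X Y [] = scal (of_real 0) (tsum X Y []))
  by exact (tsum_lscal X Y (of_real 0) []).
rewrite E re_functional_real_scal. apply Rmult_0_l.
Qed.

Lemma re_functional_elem_le x y : re (phi (elem x y)) <= norm x * norm y.
Proof.
eapply Rle_trans; [apply re_le_abs|].
eapply Rle_trans; [apply phi_le | apply proj_norm_elem_le].
Qed.

(** The phase [theta] undoes the argument of [phi] at the attaining pair; it is
    close to 1 because [phi (elem x y)], which lies between, is. *)
Lemma unit_replacement (x x0 : X) (y y0 : Y) rho eta :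
  0 < rho -> eta <= rho ^ 2 / 8 ->
  norm x = 1 -> norm y = 1 -> norm x0 = 1 -> norm y0 = 1 ->
  norm (minus x x0) <= rho / 8 -> norm (minus y y0) <= rho / 8 ->
  1 - eta < re (phi (elem x y)) -> abs (phi (elem x0 y0)) = 1 ->
  exists theta : k, abs theta <= 1 /\ re (phi (scal theta (elem x0 y0))) = 1 /\
    proj_norm X Y (minus (elem x y) (scal theta (elem x0 y0))) <= rho.
Proof.
intros Hrho Heta Hx Hy Hx0 Hy0 Hdx Hdy Hre Habs.
destruct (rotation_exists (phi (elem x0 y0))) as (theta & Htheta & Hrot).
rewrite Habs of_real_one in Hrot.
assert (H1 : abs (minus (phi (elem x y)) one) <= rho / 2).
{ apply abs_minus_one_le; [lra | | ].
  - eapply Rle_trans; [apply phi_le|].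
    pose proof (proj_norm_elem_le x y) as H. rewrite Hx Hy in H. lra.
  - replace ((rho / 2) ^ 2 / 2) with (rho ^ 2 / 8) by field. lra. }
assert (H2 : abs (minus (phi (elem x y)) (phi (elem x0 y0))) <= rho / 4).
{ rewrite -functional_minus. eapply Rle_trans; [apply phi_le|].
  pose proof (proj_norm_unit_perturbation x x0 y y0 one (rho / 8) Hy Hx0 Hy0 Hdx Hdy)
    as H.
  replace (scal one (elem x0 y0)) with (elem x0 y0) in H
    by (symmetry; exact (scal_one (elem x0 y0))).
  assert (Z : abs (minus one one : k) = 0).
  { rewrite minus_eq_zero. exact abs_zero. }
  rewrite Z in H. lra. }
assert (H3 : abs (minus (phi (elem x0 y0)) one) <= 3 / 4 * rho).
{ rewrite (minus_trans (phi (elem x y))).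
  eapply Rle_trans; [apply abs_triangle|].
  rewrite -(opp_minus (phi (elem x y))) abs_opp. lra. }
assert (H4 : abs (minus one theta) <= 3 / 4 * rho).
{ replace (minus one theta) with (mult theta (minus (phi (elem x0 y0)) one)).
  - eapply Rle_trans; [apply abs_mult|].
    pose proof (abs_ge_0 (minus (phi (elem x0 y0)) one)).
    pose proof (abs_ge_0 theta). nra.
  - unfold minus. rewrite mult_distr_l Hrot. f_equal.
    etransitivity; [exact (eq_sym (opp_mult_r theta one))|].
    apply (f_equal opp), mult_one_r. }
exists theta. split; [exact Htheta|]. split.
- rewrite (functional_scal _ Hphi) Hrot. apply re_one.
- pose proof (proj_norm_unit_perturbation x x0 y y0 theta (rho / 8)
    Hy Hx0 Hy0 Hdx Hdy). lra.
Qed.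

Context (rho eta : R) (Hrho : 0 < rho) (Heta : 0 < eta) (Heta_le : eta <= rho ^ 2 / 8).
Context (near_attaining : forall x y, norm x = 1 -> norm y = 1 ->
  1 - eta < abs (phi (elem x y)) ->
  exists x0 y0, norm x0 = 1 /\ norm y0 = 1 /\ abs (phi (elem x0 y0)) = 1 /\
    norm (minus x x0) < rho / 8 /\ norm (minus y y0) < rho / 8).

(** If the real part of [phi] almost attains its norm at [x (x) y], a nearby elementary tensor of
    the same size does the job. Otherwise the empty sum does: the defect
    [norm x * norm y - re (phi (elem x y))] is then at least [eta] times the size
    of the discarded term. *)
Lemma elem_replacement x y :
  exists m, cost X Y m <= re (phi (tsum X Y m)) /\
    proj_norm X Y (minus (elem x y) (tsum X Y m))
      <= rho * (norm x * norm y)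
         + (norm x * norm y - re (phi (elem x y))) / eta.
Proof.
pose proof (Rmult_le_pos _ _ (norm_ge_0 x) (norm_ge_0 y)) as Hc0.
pose proof (re_functional_elem_le x y) as Hdefect.
pose proof (proj_norm_elem_le x y) as Hle.
set (c := norm x * norm y) in *.
destruct (Rle_lt_dec (re (phi (elem x y))) ((1 - eta) * c)) as [Hbad|Hgood].
- exists []. split.
  + rewrite re_functional_nil. simpl. lra.
  + replace (minus (elem x y) (tsum X Y [])) with (elem x y)
      by (symmetry; exact (minus_zero_r (elem x y))).
    apply Rle_trans with c; [exact Hle|].
    assert (c <= (c - re (phi (elem x y))) / eta).
    { apply (Rmult_le_reg_r eta); [lra|]. unfold Rdiv.
      rewrite Rmult_assoc Rinv_l; lra. }
    nra.
- assert (Hc : 0 < c) by nra.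
  destruct (elem_polar x y Hc) as (x1 & y1 & Hx1 & Hy1 & E). fold c in E.
  assert (Hre : 1 - eta < re (phi (elem x1 y1))).
  { rewrite E re_functional_real_scal in Hgood. nra. }
  destruct (near_attaining x1 y1 Hx1 Hy1 (Rlt_le_trans _ _ _ Hre (re_le_abs _)))
    as (x0 & y0 & Hx0 & Hy0 & Habs & Hdx & Hdy).
  destruct (unit_replacement x1 x0 y1 y0 rho eta) as (theta & Htheta & Hval & Hdist);
    try assumption; try lra.
  exists [(scal (of_real c) (scal theta x0), y0)].
  assert (Em : tsum X Y [(scal (of_real c) (scal theta x0), y0)]
    = scal (of_real c) (scal theta (elem x0 y0))).
  { rewrite -!elem_scal_l. reflexivity. }
  rewrite Em. split.
  + rewrite re_functional_real_scal Hval. simpl. rewrite Hy0.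
    pose proof (norm_scal_real_le c (scal theta x0) Hc0).
    pose proof (norm_scal theta x0) as H'. rewrite Hx0 in H'. nra.
  + assert (Ed : minus (elem x y) (scal (of_real c) (scal theta (elem x0 y0)))
      = scal (of_real c) (minus (elem x1 y1) (scal theta (elem x0 y0)))).
    { rewrite E. symmetry.
      exact (scal_minus_distr_l (V := tensor_ModuleSpace X Y) (of_real c) _ _). }
    rewrite Ed.
    eapply Rle_trans; [apply (seminorm_scal _ (proj_norm_seminorm X Y))|].
    rewrite abs_of_real Rabs_pos_eq //.
    assert (0 <= (c - re (phi (elem x y))) / eta)
      by (apply Rdiv_le_0_compat; lra).
    nra.
Qed.

Lemma tsum_replacement l :
  exists m, cost X Y m <= re (phi (tsum X Y m)) /\
    proj_norm X Y (minus (tsum X Y l) (tsum X Y m))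
      <= rho * cost X Y l + (cost X Y l - re (phi (tsum X Y l))) / eta.
Proof.
induction l as [|[x y] l (m & Hm & Hd)].
- exists []. rewrite re_functional_nil. simpl. split; [lra|].
  replace (minus (tsum X Y []) (tsum X Y [])) with (tsum X Y [])
    by (symmetry; exact (minus_eq_zero (tsum X Y []))).
  eapply Rle_trans; [apply proj_norm_le|]. simpl. right. field. lra.
- destruct (elem_replacement x y) as (m' & Hm' & Hd').
  assert (Em : tsum X Y (m' ++ m) = plus (tsum X Y m') (tsum X Y m))
    by exact (tsum_app X Y m' m).
  exists (m' ++ m).
  rewrite cost_app Em tsum_cons !(functional_plus _ Hphi) !re_add.
  split; [lra|].
  rewrite minus_plus_plus.
  eapply Rle_trans; [apply (seminorm_triangle _ (proj_norm_seminorm X Y))|].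
  eapply Rle_trans; [exact (Rplus_le_compat _ _ _ _ Hd' Hd)|].
  right. simpl. field. lra.
Qed.

Lemma attains_of_cost_le_functional m : cost X Y m <= re (phi (tsum X Y m)) ->
  attains_proj_norm (tensor_incl (tsum X Y m)).
Proof.
intros Hm. apply attains_proj_norm_tsum.
eapply Rle_trans; [exact Hm|].
eapply Rle_trans; [apply re_le_abs | apply phi_le].
Qed.

End Replacement.

(** * The bilinear form of a norming functional *)

Section NormingForm.
Context {k : RC} {X Y : NormedModule k}.
Context (phi : tensor X Y -> k) (Hphi : linear_functional phi).
Context (phi_le : forall t, abs (phi t) <= proj_norm X Y t).

Lemma functional_bilinear_form : is_bilinear_form X Y (fun x y => phi (elem x y)).
Proof.
split; intros.
- rewrite elem_plus_l. apply (functional_plus _ Hphi).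
- rewrite elem_plus_r. apply (functional_plus _ Hphi).
- rewrite elem_scal_l. apply (functional_scal _ Hphi).
- rewrite elem_scal_r. apply (functional_scal _ Hphi).
Qed.

Lemma functional_bounded_form : bounded_form X Y (fun x y => phi (elem x y)).
Proof.
exists 1. intros x y. eapply Rle_trans; [apply phi_le|].
pose proof (proj_norm_elem_le x y). lra.
Qed.

Lemma re_functional_tsum_le b l :
  (forall x y, norm x = 1 -> norm y = 1 -> abs (phi (elem x y)) <= b) ->
  re (phi (tsum X Y l)) <= b * cost X Y l.
Proof.
intros Hb. induction l as [|[x y] l IH].
- rewrite (re_functional_nil phi Hphi). simpl. lra.
- rewrite tsum_cons (functional_plus _ Hphi) re_add. simpl.
  enough (re (phi (elem x y)) <= b * (norm x * norm y)) by lra.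
  destruct (Rmult_le_pos _ _ (norm_ge_0 x) (norm_ge_0 y)) as [Hc|Hc].
  + destruct (elem_polar x y Hc) as (x1 & y1 & Hx1 & Hy1 & E).
    rewrite E re_functional_real_scal //.
    pose proof (re_le_abs (phi (elem x1 y1))). specialize (Hb x1 y1 Hx1 Hy1). nra.
  + pose proof (re_functional_elem_le phi phi_le x y). rewrite -Hc in H |- *. lra.
Qed.

(** An upper bound [b < 1] on pairs of unit vectors would give
    [re (phi t) <= b * cost l] for representations [l] of [t] of cost arbitrarily
    close to the norm of [t]. *)
Lemma functional_form_norm t :
  0 < proj_norm X Y t -> proj_norm X Y t <= re (phi t) ->
  is_form_norm X Y (fun x y => phi (elem x y)) 1.
Proof.
intros Hpos Ht. split.
- intros r (x & y & Hx & Hy & ->). eapply Rle_trans; [apply phi_le|].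
  pose proof (proj_norm_elem_le x y) as H. rewrite Hx Hy in H. lra.
- intros b Hb. apply Rnot_lt_le; intros Hb1.
  assert (Hle : forall l, re (phi (tsum X Y l)) <= b * cost X Y l).
  { intros l. apply re_functional_tsum_le. intros x y Hx Hy. apply Hb. now exists x, y. }
  destruct (Rle_lt_dec b 0) as [Hb0|Hb0].
  + destruct (proj_norm_approx X Y t 1 Rlt_0_1) as (l & -> & _).
    specialize (Hle l). pose proof (cost_ge0 X Y l). nra.
  + destruct (proj_norm_approx X Y t (proj_norm X Y t * (1 - b) / b)) as (l & El & Hl).
    { apply Rdiv_lt_0_compat; nra. }
    specialize (Hle l). rewrite -El in Hle.
    apply (Rmult_lt_compat_l b) in Hl; [|exact Hb0].
    replace (b * (proj_norm X Y t + proj_norm X Y t * (1 - b) / b))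
      with (proj_norm X Y t) in Hl by (field; lra).
    lra.
Qed.

End NormingForm.

(** * Density *)

(** [rho] is chosen for the terms that are moved, [gamma] for those that are
    dropped: the cost of [l] exceeds the norm of [t] by less than [gamma], so the
    defects add up to at most [gamma], and the dropped terms to [gamma / eta']. *)
Lemma tensor_approximable {k : RC} {X Y : NormedModule k} (HL : property_Loo X Y)
  (t : tensor X Y) eps : 0 < eps ->
  exists w : proj_tensor X Y, attains_proj_norm w /\
    norm (minus (tensor_incl t) w) < eps.
Proof.
intros Heps.
assert (Hsub : forall l m, norm (minus (tensor_incl (tsum X Y l) : proj_tensor X Y)
    (tensor_incl (tsum X Y m))) = proj_norm X Y (minus (tsum X Y l) (tsum X Y m))).
{ intros l m. rewrite -norm_tensor_incl. apply (f_equal norm). symmetry.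
  exact (incl_minus _ _ (proj_norm_seminorm X Y) _ _). }
pose proof (p_ge0 _ _ (proj_norm_seminorm X Y) t) as HN0.
set (N := proj_norm X Y t) in *.
destruct HN0 as [HN|HN].
- destruct (hahn_banach (proj_norm X Y) t (proj_norm_seminorm X Y))
    as (phi & Hphi & phi_le & Ht). fold N in Ht.
  set (rho := eps / (4 * (N + 1))).
  assert (Hrho : 0 < rho) by (apply Rdiv_lt_0_compat; lra).
  destruct (HL (rho / 8) ltac:(lra) (fun x y => phi (elem x y)))
    as (eta & Heta & Hattain).
  { now apply functional_bilinear_form. }
  { now apply functional_bounded_form. }
  { now apply (functional_form_norm phi Hphi phi_le t). }
  set (eta' := Rmin eta (rho ^ 2 / 8)).
  assert (Heta' : 0 < eta') by (apply Rmin_pos; nra).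
  assert (Hmin1 : eta' <= eta) by apply Rmin_l.
  assert (Hmin2 : eta' <= rho ^ 2 / 8) by apply Rmin_r.
  set (gamma := Rmin 1 (eta' * eps / 4)).
  assert (Hgamma : 0 < gamma) by (apply Rmin_pos; nra).
  assert (Hgamma1 : gamma <= 1) by apply Rmin_l.
  assert (Hgamma2 : gamma <= eta' * eps / 4) by apply Rmin_r.
  destruct (proj_norm_approx X Y t gamma Hgamma) as (l & El & Hl). fold N in Hl.
  destruct (tsum_replacement phi Hphi phi_le rho eta' Hrho Heta' Hmin2) with (l := l)
    as (m & Hm & Hd).
  { intros x y Hx Hy H. apply Hattain; [exact Hx | exact Hy | lra]. }
  exists (tensor_incl (tsum X Y m)). split.
  + now apply (attains_of_cost_le_functional phi phi_le).
  + rewrite El Hsub. rewrite -El in Hd. rewrite -El.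
    eapply Rle_lt_trans; [exact Hd|].
    assert (A1 : rho * cost X Y l <= eps / 4).
    { apply Rle_trans with (rho * (N + 1)); [apply Rmult_le_compat_l; lra|].
      right. unfold rho. field. lra. }
    assert (A2 : (cost X Y l - re (phi t)) / eta' <= eps / 4).
    { apply (Rmult_le_reg_r eta'); [lra|]. unfold Rdiv at 1.
      rewrite Rmult_assoc Rinv_l; [|lra]. lra. }
    lra.
- exists (tensor_incl (tsum X Y [])). split.
  + apply attains_proj_norm_tsum. simpl.
    apply (p_ge0 _ _ (proj_norm_seminorm X Y)).
  + rewrite -(tsum_repr X Y t) Hsub tsum_repr.
    replace (minus t (tsum X Y [])) with t by (symmetry; exact (minus_zero_r t)).
    fold N. lra.
Qed.

Theorem proposition4p5 (k : RC) (X Y : CompleteNormedModule k)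
  (HL : property_Loo X Y) :
  forall z : proj_tensor X Y, closure (@attains_proj_norm k X Y) z.
Proof.
intros z eps Heps.
destruct (tensor_incl_dense z (eps / 2)) as [t Ht]; [lra|].
destruct (tensor_approximable HL t (eps / 2)) as (w & Hw & Hd); [lra|].
exists w. split; [exact Hw|].
rewrite (minus_trans (tensor_incl t)).
replace eps with (eps / 2 + eps / 2) by field.
exact (Rle_lt_trans _ _ _ (norm_triangle _ _) (Rplus_lt_compat _ _ _ _ Ht Hd)).
Qed.
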